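(* For each integer $K>2$, let $y_K$ be the unique solution in $(0,\infty)$ of the equation $$y^2=K\left((y+1)\ln(y+1)-y\right),$$ and set $a^H_K:=\frac{(y_K+K)^2}{(y_K+1)K}$. Then $a^H_KM_{-1,K}$ is a precise merging function on $[0,1]^K$. Moreover, $a^H_K\le e\ln K$ for all $K>2$, and $a^H_K/\ln K\to1$ as $K\to\infty$.
   Context: $M_{-1,K}(p_1,\dots,p_K):=\left(\frac{p_1^{-1}+\dots+p_K^{-1}}{K}\right)^{-1}$ is the harmonic mean on $[0,1]^K$ (equal to $0$ if some $p_k=0$). Fix an atomless probability space and let $\mathcal{U}$ be the set of all random variables on it uniformly distributed on $[0,1]$. A merging function is a Borel function $F:[0,1]^K\to[0,\infty)$, increasing (in the weak sense) in each argument, such that for each $\epsilon\in(0,1)$, $\sup\{\mathbb{P}(F(U_1,\dots,U_K)\le\epsilon)\mid U_1,\dots,U_K\in\mathcal{U}\}\le\epsilon$. It is precise if this supremum equals $\epsilon$ for each $\epsilon\in(0,1)$. *)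

(* Defs.v *)
From HB Require Import structures.
From mathcomp Require Import all_boot all_order all_algebra.
From mathcomp Require Import all_classical all_reals all_analysis.
Import Order.TTheory GRing.Theory Num.Theory.
Import numFieldNormedType.Exports.

Set Implicit Arguments.
Unset Strict Implicit.
Unset Printing Implicit Defensive.

Local Open Scope classical_set_scope.
Local Open Scope ring_scope.

Definition atomless (d : measure_display) (T : measurableType d)
    (R : realType) (P : probability T R) : Prop :=
  forall A : set T, measurable A -> (0 < P A)%E ->
    exists B : set T, [/\ measurable B, B `<=` A, (0 < P B)%E & (P B < P A)%E].

(* The values are required to lie in [0, 1] everywhere, not just almost surely,
   so that a function given only on the unit cube can be composed with such
   variables. *)
Definition uniform01 (d : measure_display) (T : measurableType d)
    (R : realType) (P : probability T R) : set {RV P >-> R} :=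
  [set U : {RV P >-> R} | (forall t, 0 <= U t <= 1) /\
           forall A : set R, measurable A ->
             distribution P U A = uniform_prob (@ltr01 R) A].
Arguments uniform01 {d T R} P.

Definition unit_cube (R : realType) (K : nat) : set (K.-tuple R) :=
  [set p | forall i, 0 <= tnth p i <= 1].
Arguments unit_cube : clear implicits.

Definition merging_sup (d : measure_display) (T : measurableType d)
    (R : realType) (P : probability T R) (K : nat) (F : K.-tuple R -> R)
    (eps : R) : \bar R :=
  ereal_sup [set P [set t | F [tuple U i t | i < K] <= eps]
            | U in [set U : 'I_K -> {RV P >-> R} | forall i, uniform01 P (U i)]].

(* Functions on [0, 1]^K are represented by functions on K.-tuple R, of which
   only the restriction to the cube matters. *)
Definition merging_function (d : measure_display) (T : measurableType d)
    (R : realType) (P : probability T R) (K : nat) (F : K.-tuple R -> R) :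
    Prop :=
  [/\ measurable_fun (unit_cube R K) F,
      forall p, unit_cube R K p -> 0 <= F p,
      forall (j : 'I_K) (p q : K.-tuple R), unit_cube R K p -> unit_cube R K q ->
        (forall i, i != j -> tnth p i = tnth q i) -> tnth p j <= tnth q j ->
        F p <= F q &
      forall eps : R, 0 < eps < 1 -> (merging_sup P F eps <= eps%:E)%E].

Definition precise_merging_function (d : measure_display)
    (T : measurableType d) (R : realType) (P : probability T R) (K : nat)
    (F : K.-tuple R -> R) : Prop :=
  merging_function P F /\
  forall eps : R, 0 < eps < 1 -> merging_sup P F eps = eps%:E.

(* The case distinction is needed because 0^-1 = 0 in the library. *)
Definition tuple_harmonic_mean (R : realType) (K : nat) (p : K.-tuple R) : R :=
  if [exists i, tnth p i == 0] then 0
  else ((\sum_(i < K) (tnth p i)^-1) / K%:R)^-1.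

Definition y_spec (R : realType) (K : nat) : set R :=
  [set y | 0 < y /\ y ^+ 2 = K%:R * ((y + 1) * ln (y + 1) - y)].
Arguments y_spec : clear implicits.

(* The default value 0 is used only if y_spec R K is empty. *)
Definition yH (R : realType) (K : nat) : R := xget 0 (y_spec R K).
Arguments yH : clear implicits.

Definition aH (R : realType) (K : nat) : R :=
  (yH R K + K%:R) ^+ 2 / ((yH R K + 1) * K%:R).
Arguments aH : clear implicits.

(* Main.v *)
Require Import Defs.
From HB Require Import structures.
From mathcomp Require Import all_boot all_order all_algebra.
From mathcomp Require Import all_classical all_reals all_analysis.
From mathcomp Require Import measurable_realfun.
From mathcomp Require Import ring lra.
Import Order.TTheory GRing.Theory Num.Theory.
Import numFieldNormedType.Exports.

Set Implicit Arguments.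
Unset Strict Implicit.
Unset Printing Implicit Defensive.

Local Open Scope classical_set_scope.
Local Open Scope ring_scope.

(** Put [a = aH R K]. Where no [p_i] is zero, [a * M(p) <= eps] says that
    [a * K / eps <= \sum_i 1 / p_i], so that the theorem asks for the largest
    probability with which this can happen to [K] uniform variables [U_i] of
    unrestricted dependence. This is a transport problem. Its dual is to minimise
    [K * \int_0^1 psi] over the functions [psi >= 0] such that
    [\sum_i psi(u_i) >= 1] as soon as [a * K / eps <= \sum_i 1 / u_i]; both
    problems have the value [eps].

    That the value is at most [eps] (validity) needs one dual function: truncate
    at 0 and 1 a function that is affine in [1 / u] ([dual_fun]). It has
    [K * \int_0^1 psi <= eps] because the equation for [y] expresses [ln(1 + y)]
    rationally ([dual_fun_primitive]), and [merging_sup_le] integrates it over the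
    event.

    That the value is at least [eps] (precision) has three parts.

    Every dual function [psi] has [eps <= K * \int_0^1 psi]
    ([continuous_dual_bound]). For points [u_i] near the two ends of [[0, eps]],
    integrate the constraint along one small coordinate and [K - 1] equal large
    ones. In between, put [u = 1 / (A + z)]: the constraint becomes
    [\sum_i g(z_i) >= 0] whenever [\sum_i z_i] has a given value. Such a [g] has
    a primitive above a multiple of [z * (z - c0)] ([quadratic_minorant]), and the
    contribution of this quadratic to the integral of [psi] vanishes exactly by
    the equation for [y]. The quadratic comes from joint mixes: uniform variables
    on intervals, none of them longer than all the others together, can be coupled
    so that their sum is constant. It is enough to mix three groups of variables,
    along the sides of a triangle ([three_mix]).

    Duality is needed only for tuples of cells of a subdivision of [[0, 1]], where
    it is the separation of a point from a finitely generated convex set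
    ([convex_hull_or_separated], [discrete_coupling]). A regularization turns a
    dual function on cells into a continuous one, at the cost of replacing [eps]
    by any [tau < eps] ([discrete_dual_bound]).

    An atomless space carries a uniform variable, built from a maximal chain of
    events ([exists_uniform]); from its values one reads off uniform variables
    whose tuple of cells has the law found by duality ([weighted_coupling],
    [merging_sup_ge]).

    For the estimates on [a]: [a] is the minimum over [x > 0] of
    [(K + x) * ln(1 + x) / x], attained at [y], so each [x] gives an upper bound
    ([aH_le]); [x = K - 1] yields [e * ln K] and [x = K / d] the limit. *)

(** * Real calculus *)

Lemma antiderivative (R : realType) (f : R -> R) (a : R) :
  continuous f -> exists F : R -> R, forall x, a < x -> is_derive x 1 F (f x).
Proof.
move=> cf.
pose F x : R := (\int[lebesgue_measure]_(t in [set` Interval (BLeft a) (BRight x)]) f t)%R.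
exists F => x ax.
have x1 : x < x + 1 by rewrite ltrDl.
have If : lebesgue_measure.-integrable `[a, x + 1] (EFin \o f).
  apply: continuous_compact_integrable; first exact: segment_compact.
  exact: continuous_subspaceT.
have [dF F'] := continuous_FTC1 x1 If ax (cf x).
rewrite derive1E in F'.
exact: (DeriveDef dF F').
Qed.

Lemma derive_ge_incr (R : realType) (F f : R -> R) (a b c : R) :
  a <= b -> (forall x, a <= x <= b -> is_derive x 1 F (f x)) ->
  (forall x, a < x < b -> c <= f x) -> c * (b - a) <= F b - F a.
Proof.
move=> ab dF cf; move: ab; rewrite le_eqVlt => /predU1P[<-|ab].
  by rewrite !subrr mulr0.
have [||x xab ->] := @MVT R F f a b ab.
- by move=> x; rewrite in_itv/= => /andP[ax xb]; apply: dF; rewrite !ltW.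
- apply: derivable_within_continuous => x; rewrite in_itv/= => xab.
  by have ? := dF x xab; exact: ex_derive.
- by rewrite ler_wpM2r ?subr_ge0 ?(ltW ab)//; apply: cf; rewrite in_itv/= in xab.
Qed.

Lemma derive_le_incr (R : realType) (F f : R -> R) (a b c : R) :
  a <= b -> (forall x, a <= x <= b -> is_derive x 1 F (f x)) ->
  (forall x, a < x < b -> f x <= c) -> F b - F a <= c * (b - a).
Proof.
move=> ab dF cf.
have := @derive_ge_incr R (fun x => - F x) (fun x => - f x) a b (- c) ab.
move=> H; suff : - c * (b - a) <= - F b - - F a by rewrite mulNr -opprB lerNl opprK; lra.
apply: H.
- by move=> x xab; have ? := dF x xab; apply: is_deriveN.
- by move=> x /cf; rewrite lerN2.
Qed.

Lemma derive_gt0_incr (R : realType) (F f : R -> R) (a b : R) :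
  a < b -> (forall x, a <= x <= b -> is_derive x 1 F (f x)) ->
  (forall x, a < x < b -> 0 < f x) -> F a < F b.
Proof.
move=> ab dF cf.
have [||x xab FE] := @MVT R F f a b ab.
- by move=> x; rewrite in_itv/= => /andP[ax xb]; apply: dF; rewrite !ltW.
- apply: derivable_within_continuous => x; rewrite in_itv/= => xab.
  by have ? := dF x xab; exact: ex_derive.
- by rewrite -subr_gt0 FE mulr_gt0 ?subr_gt0//; apply: cf; rewrite in_itv/= in xab.
Qed.

Lemma is_derive_comp_real (R : realType) (f g : R -> R) (df dg x : R) :
  is_derive (g x) 1 f df -> is_derive x 1 g dg ->
  is_derive x 1 (fun t => f (g t)) (df * dg).
Proof. by move=> hf hg; apply: (is_derive_eq (is_derive1_comp hf hg)); rewrite ?scalerE. Qed.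

(** The derivation rules, restated for functions written [fun t => ..] so that
    [derive_step] can match them by unification; a hypothesis supplies the
    derivative of a function that is not built from these operations. *)
Section pointwise_derivation.
Variable R : realType.
Implicit Types (f g : R -> R) (x df dg : R).

Lemma is_derive_ptD f g x df dg : is_derive x 1 f df -> is_derive x 1 g dg ->
  is_derive x 1 (fun t => f t + g t) (df + dg).
Proof. by move=> hf hg; exact: is_deriveD. Qed.

Lemma is_derive_ptN f x df : is_derive x 1 f df ->
  is_derive x 1 (fun t => - f t) (- df).
Proof. by move=> hf; exact: is_deriveN. Qed.

Lemma is_derive_ptM f g x df dg : is_derive x 1 f df -> is_derive x 1 g dg ->
  is_derive x 1 (fun t => f t * g t) (f x * dg + g x * df).
Proof. by move=> hf hg; exact: is_deriveM. Qed.

Lemma is_derive_pt_cst (c x : R) : is_derive x 1 (fun=> c) 0.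
Proof. exact: is_derive_cst. Qed.

Lemma is_derive_pt_id x : is_derive x 1 (fun t => t) 1.
Proof. exact: is_derive_id. Qed.

Lemma is_derive_ptV f x df : f x != 0 -> is_derive x 1 f df ->
  is_derive x 1 (fun t => (f t)^-1) (- (f x ^- 2) * df).
Proof.
move=> fx0 hf; have [dfx <-] := hf; apply: DeriveDef; first exact: derivableV.
by rewrite deriveV.
Qed.

Lemma is_derive_pt_ln f x df : 0 < f x -> is_derive x 1 f df ->
  is_derive x 1 (fun t => ln (f t)) ((f x)^-1 * df).
Proof. by move=> fx hf; apply: is_derive_comp_real => //; exact: is_derive1_ln. Qed.

End pointwise_derivation.

Ltac derive_step :=
  first [ notypeclasses refine (is_derive_pt_cst _ _)
    | notypeclasses refine (is_derive_pt_id _)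
    | notypeclasses refine (is_derive_ptD _ _)
    | notypeclasses refine (is_derive_ptN _)
    | notypeclasses refine (is_derive_ptM _ _)
    | notypeclasses refine (is_derive_ptV _ _)
    | notypeclasses refine (is_derive_pt_ln _ _)
    | eassumption ].
(** Leaves the side conditions of the inverse and of the logarithm, and last the
    equation between the computed and the announced derivative. *)
Ltac derive_tac :=
  notypeclasses refine (is_derive_eq _ _); [repeat derive_step; cbv beta |cbv beta].

(** * The equation for y and the size of a *)

(** The difference of the two sides of the equation for [y], divided by
    [k * (y + 1)]: its sign is that of [k * ((y + 1) * ln (y + 1) - y) - y ^+ 2],
    and its derivative is rational with the only positive zero [k - 2]. *)
Definition excess (R : realType) (k y : R) : R :=
  ln (1 + y) - y * (y + k) / (k * (y + 1)).

Lemma is_derive_excess (R : realType) (k y : R) : 0 < k -> -1 < y ->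
  is_derive y 1 (excess k) (y * (k - 2 - y) / (k * (1 + y) ^+ 2)).
Proof.
move=> k0 y1; have y10 : 0 < 1 + y by lra.
rewrite /excess; derive_tac => //.
  by apply: lt0r_neq0; apply: mulr_gt0; lra.
by field; apply/andP; split; apply: lt0r_neq0; lra.
Qed.

Lemma excess0 (R : realType) (k : R) : excess k 0 = 0.
Proof. by rewrite /excess !mul0r addr0 ln1 subr0. Qed.

Lemma excess_gt0_low (R : realType) (k y : R) : 2 < k -> 0 < y -> y <= k - 2 ->
  0 < excess k y.
Proof.
move=> k2 y0 yk; rewrite -(excess0 k).
apply: (derive_gt0_incr y0) => [x x0y|x /andP[x0 xy]].
  by apply: is_derive_excess; lra.
apply: divr_gt0; apply: mulr_gt0; rewrite ?exprn_gt0//; lra.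
Qed.

Lemma excess_decr (R : realType) (k x y : R) : 2 < k -> k - 2 <= x -> x < y ->
  excess k y < excess k x.
Proof.
move=> k2 kx xy; rewrite -ltrN2.
apply: (@derive_gt0_incr R (fun t => - excess k t)
  (fun y => - (y * (k - 2 - y) / (k * (1 + y) ^+ 2)))) => // [t xty|t /andP[tx ty]].
  by apply: is_derive_ptN; apply: is_derive_excess; lra.
rewrite -mulNr; apply: divr_gt0; last by apply: mulr_gt0; rewrite ?exprn_gt0//; lra.
by rewrite -mulrN; apply: mulr_gt0; lra.
Qed.

(** Any point with a negative value serves for the intermediate value theorem;
    at [4 * k ^+ 2] the bound [ln (1 + 2 * k) <= 2 * k], applied to half of the
    logarithm, is sufficient. *)
Lemma excess_lt0 (R : realType) (k : R) : 2 < k -> excess k (4 * k ^+ 2) < 0.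
Proof.
move=> k2; rewrite /excess subr_lt0.
have k20 : 0 < k ^+ 2 by rewrite exprn_gt0//; lra.
apply: (@le_lt_trans _ _ (4 * k)).
  apply: (@le_trans _ _ (ln ((1 + 2 * k) ^+ 2))).
    by rewrite ler_ln ?posrE ?exprn_gt0//; nra.
  rewrite lnXn; last by lra.
  have : ln (1 + 2 * k) <= 2 * k by apply: le_ln1Dx; lra.
  by rewrite mulr2n; lra.
rewrite ltr_pdivlMr; last by apply: mulr_gt0; lra.
nra.
Qed.

Lemma y_spec_excess (R : realType) (K : nat) (y : R) : (2 < K)%N ->
  y_spec R K y <-> 0 < y /\ excess K%:R y = 0.
Proof.
move=> K2; have k2 : 2 < K%:R :> R by rewrite (ltr_nat R 2).
set k := K%:R in k2 *.
rewrite /y_spec/= /excess [1 + y]addrC.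
have step (y0 : 0 < y) : y ^+ 2 - k * ((y + 1) * ln (y + 1) - y) =
    - (k * (y + 1)) * (ln (y + 1) - y * (y + k) / (k * (y + 1))).
  by field; apply/andP; split; apply: lt0r_neq0; lra.
split=> -[y0 H]; split => //; move: (step y0).
- rewrite H subrr => /esym/eqP; rewrite mulf_eq0 oppr_eq0 => /predU1P[|/eqP//].
  have : 0 < k * (y + 1) by apply: mulr_gt0; lra.
  by lra.
- by rewrite H mulr0 => /eqP; rewrite subr_eq0 => /eqP.
Qed.

Lemma y_spec_exists (R : realType) (K : nat) : (2 < K)%N ->
  exists2 y : R, y_spec R K y & K%:R - 2 < y.
Proof.
move=> K2; have k2 : 2 < K%:R :> R by rewrite (ltr_nat R 2).
set k : R := K%:R in k2 *.
have lo : 0 < excess k (k - 2) by apply: excess_gt0_low => //; lra.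
have kk : k - 2 <= 4 * k ^+ 2 by nra.
have [||y] := @IVT R (excess k) (k - 2) (4 * k ^+ 2) 0 kk.
- apply: derivable_within_continuous => x; rewrite in_itv/= => /andP[xk _].
  have k0 : 0 < k by lra. have x1 : -1 < x by lra.
  by have ? := is_derive_excess k0 x1; exact: ex_derive.
- have := excess_lt0 k2 => hi; apply/andP; split.
    by rewrite ge_min (ltW hi) orbT.
  by rewrite le_max (ltW lo).
- rewrite in_itv/= => /andP[ky _] Ey.
  have {}ky : k - 2 < y.
    by rewrite lt_neqAle ky andbT; apply/eqP => kyE; move: lo; rewrite kyE Ey ltxx.
  by exists y => //; apply/y_spec_excess => //; split => //; lra.
Qed.

(** [excess k] vanishes at 0, increases up to [k - 2] and decreases from there
    on: a positive zero lies beyond [k - 2], where there is only one. *)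
Lemma y_spec_unique (R : realType) (K : nat) (y z : R) : (2 < K)%N ->
  y_spec R K y -> y_spec R K z -> y = z.
Proof.
move=> K2; have k2 : 2 < K%:R :> R by rewrite (ltr_nat R 2).
move=> /(y_spec_excess _ K2)[y0 Ey] /(y_spec_excess _ K2)[z0 Ez].
have large (x : R) : 0 < x -> excess K%:R x = 0 -> K%:R - 2 < x.
  move=> x0 Ex; rewrite ltNge; apply/negP => /(excess_gt0_low k2 x0).
  by rewrite Ex ltxx.
have [yz|zy|//] := ltgtP y z.
- by have := excess_decr k2 (ltW (large _ y0 Ey)) yz; rewrite Ey Ez ltxx.
- by have := excess_decr k2 (ltW (large _ z0 Ez)) zy; rewrite Ey Ez ltxx.
Qed.

Lemma yHP (R : realType) (K : nat) : (2 < K)%N -> y_spec R K (yH R K).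
Proof.
move=> K2; have [y yK _] := y_spec_exists R K2.
exact: (xgetPex 0 (ex_intro _ y yK)).
Qed.

Lemma yH_gt (R : realType) (K : nat) : (2 < K)%N -> K%:R - 2 < yH R K.
Proof.
move=> K2; have [y yK ky] := y_spec_exists R K2.
by rewrite (y_spec_unique K2 (yHP R K2) yK).
Qed.

Lemma aHE (R : realType) (K : nat) : (2 < K)%N ->
  aH R K = (K%:R + yH R K) * ln (1 + yH R K) / yH R K.
Proof.
move=> K2; have k2 : 2 < K%:R :> R by rewrite (ltr_nat R 2).
have /(y_spec_excess _ K2)[y0 /eqP] := yHP R K2.
rewrite /excess subr_eq0 => /eqP ->; rewrite /aH.
by field; repeat (apply/andP; split); apply: lt0r_neq0; lra.
Qed.

(** The critical points of [(k + t) * ln (1 + t) / t] are the zeros of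
    [excess k]; this is why [aH] is the minimum of this function. *)
Lemma is_derive_aH_objective (R : realType) (k y : R) : 0 < k -> 0 < y ->
  is_derive y 1 (fun t => (k + t) * ln (1 + t) / t) (- (k / y ^+ 2 * excess k y)).
Proof.
move=> k0 y0; rewrite /excess; derive_tac; [by lra|exact: lt0r_neq0|].
by field; repeat (apply/andP; split); apply: lt0r_neq0; lra.
Qed.

Lemma aH_le (R : realType) (K : nat) (x : R) : (2 < K)%N -> 0 < x ->
  aH R K <= (K%:R + x) * ln (1 + x) / x.
Proof.
move=> K2 x0; have k2 : 2 < K%:R :> R by rewrite (ltr_nat R 2).
rewrite aHE//.
have /(y_spec_excess _ K2)[] := yHP R K2; have := yH_gt R K2.
move: (yH R K) => y ky y0 Ey.
set k : R := K%:R in k2 ky Ey *.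
have dw (t : R) : 0 < t -> is_derive t 1 (fun t => (k + t) * ln (1 + t) / t)
    (- (k / t ^+ 2 * excess k t)).
  by move=> t0; apply: is_derive_aH_objective => //; lra.
have kt (t : R) : 0 < t -> 0 <= k / t ^+ 2.
  by move=> t0; rewrite divr_ge0 ?exprn_ge0//; lra.
have [xy|yx] := leP x y.
- have := @derive_le_incr R (fun t => (k + t) * ln (1 + t) / t) _ x y 0 xy.
  rewrite mul0r subr_le0; apply.
    by move=> t /andP[xt _]; apply: dw; lra.
  move=> t /andP[xt ty]; rewrite oppr_le0; apply: mulr_ge0; first by apply: kt; lra.
  have [tk|kt'] := leP t (k - 2); first by apply: ltW; apply: excess_gt0_low => //; lra.
  by rewrite -Ey ltW// excess_decr// ltW.
- have := @derive_ge_incr R (fun t => (k + t) * ln (1 + t) / t) _ y x 0 (ltW yx).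
  rewrite mul0r subr_ge0; apply.
    by move=> t /andP[yt _]; apply: dw; lra.
  move=> t /andP[yt tx]; rewrite oppr_ge0; apply: mulr_ge0_le0; first by apply: kt; lra.
  by rewrite -Ey ltW// excess_decr// ltW.
Qed.

(** The choice [x = K - 1] gives [(2 * K - 1) / (K - 1) * ln K], and the factor
    is at most [5 / 2 < e] when [K >= 3]. *)
Lemma aH_le_elnK (R : realType) (K : nat) : (2 < K)%N ->
  aH R K <= expR 1 * ln (K%:R : R).
Proof.
move=> K2; have k3 : 3 <= K%:R :> R by rewrite (ler_nat R 3).
have := @aH_le R K (K%:R - 1) K2; set k : R := K%:R in k3 *.
rewrite subrKC => /(_ ltac:(lra)) /le_trans; apply.
have lnk : 0 <= ln k by apply: ln_ge0; lra.
rewrite mulrAC; apply: ler_wpM2r => //.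
have e25 : 5 / 2 <= expR 1 :> R.
  (* (1 + 1/8)^8 is about 2.57. *)
  have -> : 1 = 8%:R * (1 / 8) :> R by field.
  rewrite expRM_natl.
  apply: (@le_trans _ _ ((1 + 1 / 8) ^+ 8)); first by lra.
  by apply: lerXn2r; rewrite ?nnegrE ?expR_ge0 ?expR_ge1Dx//; lra.
by rewrite ler_pdivrMr; nra.
Qed.

Lemma aH_ge_lnK (R : realType) (K : nat) : (2 < K)%N ->
  ln (K%:R : R) - ln 2 <= aH R K.
Proof.
move=> K2; have k2 : 2 < K%:R :> R by rewrite (ltr_nat R 2).
rewrite aHE// -ln_div ?posrE//; last by lra.
have := yH_gt R K2; move: (yH R K) => y ky.
set k : R := K%:R in k2 ky *.
apply: (@le_trans _ _ (ln (1 + y))).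
  by rewrite ler_ln ?posrE; lra.
rewrite mulrAC ler_peMl ?ln_ge0//; first by lra.
by rewrite ler_pdivlMr; lra.
Qed.

(** The choice [x = K / d] gives the factor [1 + d] in front of
    [ln (1 + K / d)]; the bound is asymptotically [(1 + d) * ln K]. *)
Lemma aH_le_lnK (R : realType) (K : nat) (d : R) : (2 < K)%N -> 0 < d ->
  aH R K <= (1 + d) * (ln K%:R + ln (1 + d^-1)).
Proof.
move=> K2 d0; have k2 : 2 < K%:R :> R by rewrite (ltr_nat R 2).
have := @aH_le R K (K%:R / d) K2; set k : R := K%:R in k2 *.
have di0 : 0 < d^-1 by rewrite invr_gt0.
move=> /(_ ltac:(by apply: divr_gt0 => //; lra)) /le_trans; apply.
have -> : (k + k / d) * ln (1 + k / d) / (k / d) = (1 + d) * ln (1 + k / d).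
  by field; apply/andP; split; apply: lt0r_neq0; lra.
rewrite ler_pM2l; last by lra.
rewrite -lnM ?posrE; [|by lra|by lra].
have kd : 0 < k / d by apply: mulr_gt0 => //; lra.
rewrite ler_ln ?posrE; [|by lra|by apply: mulr_gt0; lra].
by lra.
Qed.

Lemma aH_ratio_cvg (R : realType) : aH R K / ln (K%:R : R) @[K --> \oo] --> (1 : R).
Proof.
apply/cvgrPdist_le => e e0.
have d0 : 0 < e / 2 by lra.
set C := ln (1 + (e / 2)^-1) : R.
near=> K.
have K2 : (2 < K)%N by near: K; exact: nbhs_infty_gt.
have M : expR (ln 2 / e + (1 + e / 2) * C / (e / 2)) <= K%:R.
  by near: K; apply: nbhs_infty_ger; exact: num_real.
have k0 : 0 < K%:R :> R by rewrite (ltr_nat R 0); exact: ltn_trans K2.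
have L0 : 0 < ln (K%:R : R) by rewrite ln_gt0// (ltr_nat R 1); exact: ltn_trans K2.
have := aH_ge_lnK R K2; have := aH_le_lnK K2 d0.
rewrite -/C; move: M; rewrite -[leRHS]lnK ?posrE// ler_expR.
have C0 : 0 <= C by apply: ln_ge0; rewrite lerDl invr_ge0 ltW.
have l2 : 0 <= ln (2 : R) by apply: ln_ge0; lra.
move: (ln _ ) L0 => L L0 M up lo.
have M1 : ln 2 <= e * L.
  rewrite mulrC -ler_pdivrMr//; apply: le_trans M; rewrite lerDl.
  by apply: divr_ge0; [apply: mulr_ge0 => //; lra|lra].
have M2 : (1 + e / 2) * C <= e / 2 * L.
  rewrite -ler_pdivrMl// [leLHS]mulrC; apply: le_trans M.
  by rewrite lerDr divr_ge0// ltW.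
rewrite ler_norml; apply/andP; split.
  suff : aH R K / L <= 1 + e by lra.
  rewrite ler_pdivrMr//; apply: (le_trans up); lra.
suff : 1 - e <= aH R K / L by lra.
rewrite ler_pdivlMr//; apply: le_trans lo; lra.
Unshelve. all: by end_near. Qed.

(** * Joint mixes of uniform variables *)

Lemma is_derive_pt_sum (R : realType) (I : Type) (s : seq I) (Q : pred I)
    (F : I -> R -> R) (df : I -> R) (x : R) :
  (forall i, Q i -> is_derive x 1 (F i) (df i)) ->
  is_derive x 1 (fun t => \sum_(i <- s | Q i) F i t) (\sum_(i <- s | Q i) df i).
Proof.
move=> dF; elim: s => [|i s IH].
  by under eq_fun do rewrite big_nil; rewrite big_nil; exact: is_derive_pt_cst.
under eq_fun do rewrite big_cons; rewrite big_cons.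
by case: ifPn => // Qi; apply: is_derive_ptD => //; exact: dF.
Qed.

(** Let the point [(u1 + d1 * t, u2 + d2 * t, u3 + d3 * t)] run through a segment
    of the plane [al * t1 + be * t2 + ga * t3 = sg] carrying the mass [w]. The
    nonnegative function [f1 + f2 + f3], integrated over the segment, is the sum
    of the integrals of the [fi] over its projections, on which the density is
    [ci = w / di], up to sign. *)
Lemma segment_mix (R : realType) (P1 P2 P3 f1 f2 f3 : R -> R)
    (al be ga sg w u1 u2 u3 d1 d2 d3 c1 c2 c3 : R) :
  (forall t : R, 0 <= t <= 1 -> is_derive t 1 P1 (f1 t)) ->
  (forall t : R, 0 <= t <= 1 -> is_derive t 1 P2 (f2 t)) ->
  (forall t : R, 0 <= t <= 1 -> is_derive t 1 P3 (f3 t)) ->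
  (forall t1 t2 t3 : R, 0 <= t1 <= 1 -> 0 <= t2 <= 1 -> 0 <= t3 <= 1 ->
     al * t1 + be * t2 + ga * t3 = sg -> 0 <= f1 t1 + f2 t2 + f3 t3) ->
  0 <= w -> c1 * d1 = w -> c2 * d2 = w -> c3 * d3 = w ->
  0 <= u1 <= 1 -> 0 <= u2 <= 1 -> 0 <= u3 <= 1 ->
  0 <= u1 + d1 <= 1 -> 0 <= u2 + d2 <= 1 -> 0 <= u3 + d3 <= 1 ->
  al * u1 + be * u2 + ga * u3 = sg -> al * d1 + be * d2 + ga * d3 = 0 ->
  0 <= c1 * (P1 (u1 + d1) - P1 u1) + c2 * (P2 (u2 + d2) - P2 u2)
     + c3 * (P3 (u3 + d3) - P3 u3).
Proof.
move=> D1 D2 D3 f0 w0 cd1 cd2 cd3 u1b u2b u3b v1b v2b v3b us ds.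
have between (u d t : R) : 0 <= u <= 1 -> 0 <= u + d <= 1 -> 0 <= t <= 1 ->
    0 <= u + d * t <= 1.
  by move=> *; apply/andP; split; nra.
have dP (P f : R -> R) (u d c t : R) :
    (forall t : R, 0 <= t <= 1 -> is_derive t 1 P (f t)) -> c * d = w ->
    0 <= u <= 1 -> 0 <= u + d <= 1 -> 0 <= t <= 1 ->
    is_derive t 1 (fun t : R => c * P (u + d * t)) (w * f (u + d * t)).
  move=> D cd ub vb tb.
  have ? : is_derive t 1 (fun t : R => P (u + d * t)) (f (u + d * t) * d).
    apply: is_derive_comp_real; first by apply: D; exact: between.
    by derive_tac; ring.
  by derive_tac; rewrite -cd; ring.
pose F (t : R) := c1 * P1 (u1 + d1 * t) + c2 * P2 (u2 + d2 * t) + c3 * P3 (u3 + d3 * t).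
have := @derive_ge_incr R F (fun t : R => w * f1 (u1 + d1 * t)
  + w * f2 (u2 + d2 * t) + w * f3 (u3 + d3 * t)) 0 1 0 ler01.
rewrite mul0r /F !mulr1 !mulr0 !addr0 => H.
have {}H := H _ _; suff: 0 <= F 1 - F 0 by rewrite /F !mulr1 !mulr0 !addr0; lra.
rewrite /F !mulr1 !mulr0 !addr0; apply: H => t tb.
  by apply: is_derive_ptD; [apply: is_derive_ptD|]; exact: dP.
rewrite -!mulrDr mulr_ge0//; apply: f0.
- by apply: between => //; lra.
- by apply: between => //; lra.
- by apply: between => //; lra.
- have -> : al * (u1 + d1 * t) + be * (u2 + d2 * t) + ga * (u3 + d3 * t)
    = (al * u1 + be * u2 + ga * u3) + t * (al * d1 + be * d2 + ga * d3) by ring.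
  by rewrite us ds mulr0 addr0.
Qed.

(** Three uniform variables on [[0, 1]] can be coupled so that
    [(q + r) * t1 + (p + r) * t2 + (p + q) * t3] is constant: these coefficients
    are any three numbers satisfying the triangle inequalities. The coupling lives
    on the triangle with vertices [(0, 1, c)], [(a, 0, 1)], [(1, b, 0)]; the
    weights of its sides, proportional to [p * r], [p * q], [q * r], make all
    three projections uniform. Integrating [f1 + f2 + f3 >= 0] against it gives
    the sum of the three means. *)
Lemma three_mix (R : realType) (P1 P2 P3 f1 f2 f3 : R -> R) (p q r : R) :
  0 <= p -> 0 <= q -> 0 <= r -> 0 < q + r -> 0 < p + r ->
  (forall t : R, 0 <= t <= 1 -> is_derive t 1 P1 (f1 t)) ->
  (forall t : R, 0 <= t <= 1 -> is_derive t 1 P2 (f2 t)) ->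
  (forall t : R, 0 <= t <= 1 -> is_derive t 1 P3 (f3 t)) ->
  (forall t1 t2 t3 : R, 0 <= t1 <= 1 -> 0 <= t2 <= 1 -> 0 <= t3 <= 1 ->
     (q + r) * t1 + (p + r) * t2 + (p + q) * t3 = p + q + r ->
     0 <= f1 t1 + f2 t2 + f3 t3) ->
  0 <= (P1 1 - P1 0) + (P2 1 - P2 0) + (P3 1 - P3 0).
Proof.
move=> p0 q0 r0 al0 be0 D1 D2 D3 f0.
(* If p = q = 0, the triangle shrinks to a single segment. *)
have [ga0|] := ltP 0 (p + q); last first.
  move=> pq; have {pq} [pE qE] : p = 0 /\ q = 0 by split; lra.
  have := @segment_mix R P1 P2 P3 f1 f2 f3 _ _ _ _ 1 0 1 0 1 (-1) 1 1 (-1) 1 D1 D2 D3 f0.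
  rewrite pE qE add0r subrr.
  move=> H; suff : 0 <= 1 * (P1 1 - P1 0) + -1 * (P2 0 - P2 1) + 1 * (P3 1 - P3 0).
    by lra.
  by apply: H; rewrite ?lexx ?ler01 //; lra.
pose a := r / (q + r); pose b := p / (p + r); pose c := q / (p + q).
have aE : (q + r) * a = r by rewrite mulrC divfK// gt_eqF.
have bE : (p + r) * b = p by rewrite mulrC divfK// gt_eqF.
have cE : (p + q) * c = q by rewrite mulrC divfK// gt_eqF.
have a1 : 0 <= a <= 1 by rewrite divr_ge0 ?(ltW al0)//= ler_pdivrMr//; lra.
have b1 : 0 <= b <= 1 by rewrite divr_ge0 ?(ltW be0)//= ler_pdivrMr//; lra.
have c1 : 0 <= c <= 1 by rewrite divr_ge0 ?(ltW ga0)//= ler_pdivrMr//; lra.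
clearbody a b c.
(* The three sides of the triangle. *)
have AB : 0 <= p * (q + r) * (P1 a - P1 0) + - (p * r) * (P2 0 - P2 1)
    + r * (p + q) * (P3 1 - P3 c).
  have := @segment_mix R P1 P2 P3 f1 f2 f3 _ _ _ _ (p * r) 0 1 c a (-1) (1 - c)
    (p * (q + r)) (- (p * r)) (r * (p + q)) D1 D2 D3 f0.
  rewrite add0r subrr subrKC; apply; first [lra|nra].
have BC : 0 <= p * (q + r) * (P1 1 - P1 a) + q * (p + r) * (P2 b - P2 0)
    + - (p * q) * (P3 0 - P3 1).
  have := @segment_mix R P1 P2 P3 f1 f2 f3 _ _ _ _ (p * q) a 0 1 (1 - a) b (-1)
    (p * (q + r)) (q * (p + r)) (- (p * q)) D1 D2 D3 f0.
  rewrite add0r subrr subrKC; apply; first [lra|nra].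
have AC : 0 <= q * r * (P1 1 - P1 0) + - (q * (p + r)) * (P2 b - P2 1)
    + - (r * (p + q)) * (P3 0 - P3 c).
  have := @segment_mix R P1 P2 P3 f1 f2 f3 _ _ _ _ (q * r) 0 1 c 1 (b - 1) (- c)
    (q * r) (- (q * (p + r))) (- (r * (p + q))) D1 D2 D3 f0.
  rewrite add0r subrKC subrr; apply; first [lra|nra].
have S0 : 0 < p * q + p * r + q * r.
  have pq := mulr_ge0 p0 q0; have pr := mulr_ge0 p0 r0; have qr := mulr_ge0 q0 r0.
  have [p_gt0|p_le0] := ltP 0 p; first by have := mulr_gt0 p_gt0 al0; lra.
  have q_gt0 : 0 < q by lra.
  have r_gt0 : 0 < r by lra.
  by have := mulr_gt0 q_gt0 r_gt0; lra.
rewrite -(pmulr_rge0 _ S0); lra.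
Qed.

(** The mean over [[l, l + a]] of a function [g] with primitive [Gam]; a
    degenerate interval gives the value at its only point. *)
Definition interval_mean (R : realType) (Gam g : R -> R) (l a : R) : R :=
  if a == 0 then g l else (Gam (l + a) - Gam l) / a.

Lemma interval_mean_primitive (R : realType) (Gam g : R -> R) (l a : R) :
  (forall x : R, -1 < x -> is_derive x 1 Gam (g x)) -> 0 <= l -> 0 <= a ->
  exists2 P : R -> R, forall t : R, 0 <= t <= 1 -> is_derive t 1 P (g (l + a * t)) &
    P 1 - P 0 = interval_mean Gam g l a.
Proof.
move=> dG l0 a0; rewrite /interval_mean; case: eqP => [->|/eqP a_neq0].
  exists (fun t : R => g l * t) => [t _|]; last by rewrite mulr1 mulr0 subr0.
  by derive_tac; rewrite mul0r addr0; ring.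
exists (fun t : R => Gam (l + a * t) * a^-1) => [t tb|].
  have ? : is_derive t 1 (fun t : R => Gam (l + a * t)) (g (l + a * t) * a).
    apply: is_derive_comp_real; last by derive_tac; ring.
    by apply: dG; nra.
  by derive_tac; field.
by rewrite mulr1 mulr0 addr0 mulrBl.
Qed.

Lemma alternating_sum_bounds (R : realType) (m : nat) (a : nat -> R) :
  (forall i, 0 <= a i) -> (forall i, a i.+1 <= a i) ->
  0 <= \sum_(i < m | ~~ odd i) a i - \sum_(i < m | odd i) a i <= a 0%N.
Proof.
elim: m a => [|m IH] a a0 aS; first by rewrite !big_ord0 subrr lexx a0.
have := IH (fun i => a i.+1) (fun i => a0 i.+1) (fun i => aS i.+1).
have -> : \sum_(i < m.+1 | ~~ odd i) a i = a 0%N + \sum_(i < m | odd i) a i.+1.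
  rewrite big_mkcond big_ord_recl/=; congr (_ + _).
  by rewrite [RHS]big_mkcond; apply: eq_bigr => i _; rewrite negbK.
have -> : \sum_(i < m.+1 | odd i) a i = \sum_(i < m | ~~ odd i) a i.+1.
  rewrite big_mkcond big_ord_recl/= add0r.
  by rewrite [RHS]big_mkcond; apply: eq_bigr => i _.
have := aS 0%N; lra.
Qed.

(** Uniform variables on the intervals [[l_i, l_i + a_i]] have a coupling with
    constant sum if the longest interval is at most as long as all the others
    together. Let the intervals of even rank move together, and likewise those of
    odd rank: since the lengths decrease, the total lengths of these two groups
    and the length [a0] satisfy the triangle inequalities, and [three_mix]
    integrates the inequality for [g] against such a coupling. *)
Lemma uniform_block_mean_ge0 (R : realType) (Gam g : R -> R) (m : nat)
    (l0 a0 : R) (l a : nat -> R) :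
  (forall x : R, -1 < x -> is_derive x 1 Gam (g x)) ->
  0 <= l0 -> (forall i, 0 <= l i) -> (forall i, 0 <= a i) ->
  (forall i, a i.+1 <= a i) -> a 0%N <= a0 -> 0 < a 0%N -> (0 < m)%N ->
  a0 <= \sum_(i < m) a i ->
  (forall (z0 : R) (z : nat -> R), 0 <= z0 -> (forall i, 0 <= z i) ->
     z0 + \sum_(i < m) z i = (l0 + a0 / 2) + \sum_(i < m) (l i + a i / 2) ->
     0 <= g z0 + \sum_(i < m) g (z i)) ->
  0 <= interval_mean Gam g l0 a0 + \sum_(i < m) interval_mean Gam g (l i) (a i).
Proof.
move=> dG l0_ge0 l_ge0 a_ge0 aS a_le_a0 a_gt0 m_gt0 a0_le g_ge0.
have a0_ge0 : 0 <= a0 by apply: le_trans a_le_a0.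
have [P0 dP0 <-] := interval_mean_primitive dG l0_ge0 a0_ge0.
have prim i := interval_mean_primitive dG (l_ge0 i) (a_ge0 i).
pose P i := sval (cid2 (prim i)).
have dP i : forall t : R, 0 <= t <= 1 -> is_derive t 1 (P i) (g (l i + a i * t)).
  by rewrite /P; case: cid2.
have PE i : P i 1 - P i 0 = interval_mean Gam g (l i) (a i).
  by rewrite /P; case: cid2.
have split_parity (F : nat -> R) : \sum_(i < m) F i =
    \sum_(i < m | ~~ odd i) F i + \sum_(i < m | odd i) F i.
  by rewrite (bigID (fun i : 'I_m => ~~ odd i))/=; under [X in _ + X = _]eq_bigl do rewrite negbK.
set S1 := \sum_(i < m | ~~ odd i) a i; set S2 := \sum_(i < m | odd i) a i.
have aE : \sum_(i < m) a i = S1 + S2 by rewrite split_parity.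
have /andP[S12 S12a] : 0 <= S1 - S2 <= a 0%N by exact: alternating_sum_bounds.
have S2_ge0 : 0 <= S2 by exact: sumr_ge0.
have S1_gt0 : 0 < S1.
  case: m m_gt0 @S1 @S2 {a0_le g_ge0 split_parity aE S12 S12a S2_ge0} => // m _ S1 S2.
  by rewrite /S1 big_mkcond big_ord_recl/= ltr_wpDr// sumr_ge0// => i _; case: ifP.
have := @three_mix R P0 (fun t => \sum_(i < m | ~~ odd i) P i t)
  (fun t => \sum_(i < m | odd i) P i t) (fun t => g (l0 + a0 * t))
  (fun t => \sum_(i < m | ~~ odd i) g (l i + a i * t))
  (fun t => \sum_(i < m | odd i) g (l i + a i * t))
  ((S1 + S2 - a0) / 2) ((a0 + S2 - S1) / 2) ((a0 + S1 - S2) / 2).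
have -> : (a0 + S2 - S1) / 2 + (a0 + S1 - S2) / 2 = a0 by field.
have -> : (S1 + S2 - a0) / 2 + (a0 + S1 - S2) / 2 = S1 by field.
have -> : (S1 + S2 - a0) / 2 + (a0 + S2 - S1) / 2 = S2 by field.
have -> : S2 + (a0 + S1 - S2) / 2 = (a0 + (S1 + S2)) / 2 by field.
move=> H.
rewrite (eq_bigr (fun i : 'I_m => P i 1 - P i 0)) => [|i _]; last by rewrite PE.
rewrite (split_parity (fun i => P i 1 - P i 0)) !sumrB addrA.
apply: H => //; try by lra.
- by move=> t tb; apply: (@is_derive_pt_sum _ _ _ _ _ (fun i : 'I_m => g (l i + a i * t))) => i _; exact: dP.
- by move=> t tb; apply: (@is_derive_pt_sum _ _ _ _ _ (fun i : 'I_m => g (l i + a i * t))) => i _; exact: dP.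
- move=> t1 t2 t3 t1b t2b t3b tE.
  pose z i := l i + a i * (if odd i then t3 else t2).
  have t_ge0 i : 0 <= (if odd i then t3 else t2) by case: ifP => _; lra.
  have : 0 <= g (l0 + a0 * t1) + \sum_(i < m) g (z i).
    apply: g_ge0 => [|i|]; first by rewrite addr_ge0// mulr_ge0//; lra.
      by rewrite addr_ge0// mulr_ge0.
    rewrite !big_split/= -mulr_suml aE.
    suff -> : \sum_(i < m) a i * (if odd i then t3 else t2) = S1 * t2 + S2 * t3 by lra.
    rewrite (split_parity (fun i => a i * (if odd i then t3 else t2))) !mulr_suml.
    congr (_ + _); apply: eq_bigr => i; last by move=> ->.
    by move=> /negbTE ->.
  rewrite (split_parity (g \o z)) addrA /z /=.
  under eq_bigr => i /negbTE -> do []; under [X in _ + X]eq_bigr => i -> do [].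
  by [].
Qed.

(** Write [M x] for the mean of [g] over [[0, x]]. The line
    [mu + lam * (x - c0)] lies below [M] and touches it at [b] and [c]. Since
    [Gam] is then above the parabola [x * (mu + lam * (x - c0))] and equal to it
    at [b] and [c], the mean of [g] over an interval ending at [b] or [c] is at
    most the chord slope of the parabola. Now choose [N] such intervals
    satisfying the hypothesis of [uniform_block_mean_ge0], with midpoints summing
    to [L]: the terms in [lam] cancel, and [0 <= N * mu] is left. *)
Lemma affine_minorant_ge0 (R : realType) (Gam g : R -> R) (m : nat)
    (L mu lam b c : R) :
  let N := m.+1%:R in let c0 := 2 * L / N in
  (1 < m)%N -> 0 < L -> (forall x : R, -1 < x -> is_derive x 1 Gam (g x)) ->
  Gam 0 = 0 ->
  (forall (z0 : R) (z : nat -> R), 0 <= z0 -> (forall i, 0 <= z i) ->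
     z0 + \sum_(i < m) z i = L -> 0 <= g z0 + \sum_(i < m) g (z i)) ->
  0 <= b -> b < c -> c0 < c -> c <= L -> b <= c0 ->
  (forall x : R, 0 <= x <= L -> x * (mu + lam * (x - c0)) <= Gam x) ->
  interval_mean Gam g 0 b = mu + lam * (b - c0) ->
  interval_mean Gam g 0 c = mu + lam * (c - c0) ->
  0 <= mu.
Proof.
move=> N c0 m1 L0 dG G0 g_ge0 b0 bc c0c cL bc0 QG Gb Gc.
have N0 : 0 < N by rewrite ltr0n.
have Nc0 : N * c0 = 2 * L by rewrite mulrC divfK// gt_eqF.
have c_gt0 : 0 < c by lra.
have mN : m%:R = N - 1 :> R by rewrite /N -natr1 addrK.
have N3 : 3 <= N by rewrite ler_nat.
have sum_cst (x : R) : \sum_(i < m) x = x * (N - 1).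
  by rewrite sumr_const card_ord -mulr_natr mN.
have GbE : Gam b = b * (mu + lam * (b - c0)).
  move: Gb; rewrite /interval_mean add0r G0 subr0; case: eqP => [-> _|/eqP bn <-].
    by rewrite G0 mul0r.
  by rewrite mulrC divfK.
have GcE : Gam c = c * (mu + lam * (c - c0)).
  move: Gc; rewrite /interval_mean add0r G0 subr0 gt_eqF// => <-.
  by rewrite mulrC divfK// gt_eqF.
have mean_le (q d : R) : 0 <= q -> q < d -> d <= L -> Gam d = d * (mu + lam * (d - c0)) ->
    interval_mean Gam g q (d - q) <= mu + lam * (d + q - c0).
  move=> q0 qd dL Gd; rewrite /interval_mean subr_eq0 gt_eqF// subrKC Gd.
  rewrite ler_pdivrMr ?subr_gt0//.
  have := QG q; rewrite q0/= => /(_ ltac:(lra)); lra.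
(* If b > L / N, take N times the interval [c0 - b, b], with midpoint L / N. *)
have [bN|bN] := ltP L (N * b).
  pose p := c0 - b.
  have p0 : 0 <= p by rewrite subr_ge0.
  have pb : p < b by rewrite -(ltr_pM2l N0) /p mulrBr Nc0; lra.
  have := @uniform_block_mean_ge0 R Gam g m p (b - p) (fun=> p) (fun=> b - p) dG p0.
  rewrite !sum_cst.
  have -> : p + (b - p) / 2 + (p + (b - p) / 2) * (N - 1) = L.
    by rewrite -[L](mulKf (_ : 2 != 0))// -Nc0 /p; field.
  move=> H.
  have {H} : 0 <= N * interval_mean Gam g p (b - p).
    have -> : N * interval_mean Gam g p (b - p) =
      interval_mean Gam g p (b - p) + interval_mean Gam g p (b - p) * (N - 1) by ring.
    apply: H => [//|_|//|//||||//]; [by lra|by lra|exact: ltn_trans m1|].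
    by rewrite ler_peMr; lra.
  rewrite pmulr_rge0// => /le_trans; move: (mean_le p b p0 pb ltac:(lra) GbE).
  by move=> /[swap] /[apply]; rewrite /p subrKC subrr mulr0 addr0.
(* Otherwise take K intervals [q, c] and N - K intervals [0, b], where q is
   fixed by the sum of the midpoints; 0 <= q < c - b forces K to be the integer
   part of j. *)
have bc_gt0 : 0 < c - b by rewrite subr_gt0.
pose j := (2 * L - N * b) / (c - b).
have jE : j * (c - b) = 2 * L - N * b by rewrite divfK// gt_eqF.
have j1 : 1 <= j by rewrite ler_pdivlMr//; lra.
have jN : j < N by rewrite ltr_pdivrMr//; nra.
have [k [k1 kj jk]] : exists k, [/\ (0 < k)%N, k%:R <= j & j < k%:R + 1].
  exists (Num.truncn j); split.
  - by rewrite truncn_gt0.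
  - by rewrite truncn_le; lra.
  - by rewrite natr1 truncnS_gt.
have km : (k <= m)%N.
  by rewrite -ltnS -(ltr_nat R); apply: le_lt_trans jN.
case: k k1 kj jk km => // k _; rewrite -natr1 => kj jk km.
pose K := k%:R + 1 : R.
have K1 : 1 <= K by rewrite lerDr.
have KE : k%:R = K - 1 :> R by rewrite addrK.
have K0 : 0 < K by lra.
rewrite -/K in kj jk.
pose q := (2 * L - K * c - (N - K) * b) / K.
have qE : K * q = 2 * L - K * c - (N - K) * b by rewrite mulrC divfK// gt_eqF.
have q0 : 0 <= q by apply: divr_ge0; nra.
have qcb : q < c - b by rewrite ltr_pdivrMr//; nra.
pose l i := if (i < k)%N then q else 0.
pose a i := if (i < k)%N then c - q else b.
have sum_lk (x y : R) : \sum_(i < m) (if (i < k)%N then x else y) = (K - 1) * x + (N - K) * y.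
  have -> : \sum_(i < m) (if (i < k)%N then x else y) = \sum_(i < m) (y + (if (i < k)%N then x - y else 0)).
    by apply: eq_bigr => i _; case: ifP => _; lra.
  rewrite big_split/= sum_cst -big_mkcond/=.
  have -> : \sum_(i < m | (i < k)%N) (x - y) = \sum_(i < k) (x - y).
    by rewrite (big_ord_widen m (fun=> x - y))// ltnW.
  by rewrite sumr_const card_ord -mulr_natr KE; ring.
have := @uniform_block_mean_ge0 R Gam g m q (c - q) l a dG q0.
have aE : \sum_(i < m) a i = (K - 1) * (c - q) + (N - K) * b by rewrite -sum_lk.
have zE : q + (c - q) / 2 + \sum_(i < m) (l i + a i / 2) = L.
  rewrite big_split/= -mulr_suml aE /l sum_lk.
  rewrite -[RHS](mulKf (_ : 2 != 0))//. nra.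
rewrite aE zE => H.
have {H} : 0 <= interval_mean Gam g q (c - q) +
   \sum_(i < m) interval_mean Gam g (l i) (a i).
  apply: H => //.
  - by move=> i; rewrite /l; case: ifP.
  - by move=> i; rewrite /a; case: ifP => _; lra.
  - move=> i; rewrite /a; case: ifP => [ik|_]; first by rewrite (ltnW ik).
    by case: ifP => _; lra.
  - by rewrite /a; case: ifP => _; lra.
  - rewrite /a; case: ifP => [_|k0]; first by lra.
    have k_eq0 : k = 0%N by case: (k) k0.
    have K1E : K = 1 by rewrite /K k_eq0 add0r.
    rewrite lt_neqAle b0 andbT; apply/eqP => b0E.
    by move: qE; rewrite K1E -b0E; lra.
  - exact: ltn_trans m1.
  - case: (posnP k) => [k_eq0|k_gt0].
      have K1E : K = 1 by rewrite /K k_eq0 add0r.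
      by move: qE; rewrite K1E; lra.
    have K2 : 2 <= K by rewrite /K natr1 ler_nat.
    have : 0 <= (K - 2) * (c - q) by apply: mulr_ge0; lra.
    have : 0 <= (N - K) * b by apply: mulr_ge0 => //; lra.
    lra.
have -> : \sum_(i < m) interval_mean Gam g (l i) (a i) =
    (K - 1) * interval_mean Gam g q (c - q) + (N - K) * interval_mean Gam g 0 b.
  by rewrite -sum_lk; apply: eq_bigr => i _; rewrite /l /a; case: ifP.
rewrite Gb; have := mean_le q c q0 ltac:(lra) cL GcE.
set I := interval_mean Gam g q (c - q) => leI geI.
have : 0 <= K * (mu + lam * (c + q - c0)) + (N - K) * (mu + lam * (b - c0)).
  have : K * I <= K * (mu + lam * (c + q - c0)) by rewrite ler_pM2l.
  lra.
have -> : K * (mu + lam * (c + q - c0)) + (N - K) * (mu + lam * (b - c0)) =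
    N * mu + lam * (K * c + K * q + (N - K) * b - N * c0) by ring.
rewrite qE Nc0 (_ : _ - _ = 0) ?mulr0 ?addr0; last by ring.
by rewrite pmulr_rge0.
Qed.

Lemma interval_mean_continuous (R : realType) (Gam g : R -> R) (x : R) :
  (forall x : R, -1 < x -> is_derive x 1 Gam (g x)) -> -1 < x ->
  {for x, continuous (interval_mean Gam g 0)}.
Proof.
move=> dG x1; have [->|x0] := eqVneq x 0.
  have [dG0 dGE] := dG 0 ltac:(lra).
  rewrite /prop_for /continuous_at /interval_mean eqxx.
  apply/cvgrPdist_lt => e e0.
  have : h^-1 *: (Gam (h *: 1 + 0) - Gam 0) @[h --> 0^'] --> g 0.
    by rewrite -dGE.
  move=> /cvgrPdist_lt/(_ e e0); rewrite near_withinE => H.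
  apply: filterS H => t /= H; case: ifPn => [_|t0]; first by rewrite subrr normr0.
  by have := H t0; rewrite scaler1 addr0 add0r mulrC.
have E : \forall t \near x, (Gam t - Gam 0) / t = interval_mean Gam g 0 t.
  have : \forall t \near x, t != 0 by exact: open_nbhs_nbhs.
  by apply: filterS => t t0; rewrite /interval_mean (negbTE t0) add0r.
rewrite /prop_for /continuous_at {2}/interval_mean (negbTE x0) add0r.
apply: cvg_trans (near_eq_cvg E) _.
apply: cvgM; last by apply: cvgV.
apply: cvgB; last exact: cvg_cst.
by apply: differentiable_continuous; apply/derivable1_diffP; have ? := dG x x1; exact: ex_derive.
Qed.

Lemma min_chord_value (R : realType) (M : R -> R) (c0 L : R) :
  0 <= c0 -> c0 <= L -> (forall x : R, 0 <= x -> {for x, continuous M}) ->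
  let chord (b c w : R) := [/\ 0 <= b <= c0, c0 <= c <= L, 0 <= w <= 1 &
                         w * b + (1 - w) * c = c0] in
  exists b c w : R, chord b c w /\ forall b' c' w' : R, chord b' c' w' ->
    w * M b + (1 - w) * M c <= w' * M b' + (1 - w') * M c'.
Proof.
move=> c00 c0L cM chord.
pose M' (x : R) := M (Num.max 0 x).
have cM' : continuous M'.
  move=> x; apply: continuous_comp; last by apply: cM; rewrite le_max lexx.
  by apply: continuous_max; [exact: cst_continuous|exact: cvg_id].
pose B := (`[0, c0] `*` `[c0, L]) `*` `[0, 1] : set (R * R * R).
pose h (x : R * R * R) := x.2 * x.1.1 + (1 - x.2) * x.1.2.
have c1 : continuous (fun x : R * R * R => x.1.1).
  by move=> x; apply: continuous_comp; exact: cvg_fst.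
have c2 : continuous (fun x : R * R * R => x.1.2).
  by move=> x; apply: continuous_comp; [exact: cvg_fst|exact: cvg_snd].
have c3 : continuous (fun x : R * R * R => x.2).
  by move=> x; exact: cvg_snd.
have cD (u v : R * R * R -> R) : continuous u -> continuous v ->
    continuous (fun x => u x + v x) by move=> cu cv x; exact: cvgD (cu x) (cv x).
have cM2 (u v : R * R * R -> R) : continuous u -> continuous v ->
    continuous (fun x => u x * v x) by move=> cu cv x; exact: cvgM (cu x) (cv x).
have c4 : continuous (fun x : R * R * R => 1 - x.2).
  by apply: cD => x; [exact: cvg_cst|exact: cvgN (c3 x)].
have ch : continuous h by apply: cD; exact: cM2.
pose A := B `&` [set x | h x = c0].
have compA : compact A.
  apply: compact_closedI; last first.
    by apply: (@preimage_closed _ _ h [set c0]) => [x _|]; [exact: ch|exact: closed_eq].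
  by apply: compact_setX; first apply: compact_setX; exact: segment_compact.
pose f (x : R * R * R) := x.2 * M' x.1.1 + (1 - x.2) * M' x.1.2.
have cf : continuous f.
  by apply: cD; apply: cM2 => // x; apply: continuous_comp; [exact: c1|exact: cM'|exact: c2|exact: cM'].
have AE b c w : A (b, c, w) <-> chord b c w.
  rewrite /A /B /chord /h/= !in_itv/=; split; first by case=> [[[]]].
  by case.
have [||[[b c] w]] := @compact_EVT_min _ _ f A _ compA.
- exists (c0, c0, 1); apply/AE; split; rewrite ?lexx ?c00 ?c0L ?ler01//.
  by rewrite mul1r subrr mul0r addr0.
- exact: continuous_subspaceT.
rewrite inE => /AE bcw min_bcw; exists b, c, w; split => // b' c' w' bcw'.
have := min_bcw (b', c', w'); rewrite inE => /(_ ((AE _ _ _).2 bcw')).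
move: bcw bcw' => [/andP[b0 _] /andP[cc _] _ _] [/andP[b0' _] /andP[cc' _] _ _].
by rewrite /f /M'/= !max_r// (le_trans c00).
Qed.

(** With [M x] the mean of [g] over [[0, x]], the claim is that a line through
    [(c0, 0)] stays below [M], and such a line exists if no chord of [M] passes
    below this point. If one does, the chord with the lowest value [mu < 0] at
    [c0] exists by compactness and spans a line that stays below [M], which
    contradicts [affine_minorant_ge0]. *)
Lemma quadratic_minorant (R : realType) (Gam g : R -> R) (m : nat) (L : R) :
  let c0 := 2 * L / m.+1%:R in
  (1 < m)%N -> 0 < L -> (forall x : R, -1 < x -> is_derive x 1 Gam (g x)) ->
  Gam 0 = 0 ->
  (forall (z0 : R) (z : nat -> R), 0 <= z0 -> (forall i, 0 <= z i) ->
     z0 + \sum_(i < m) z i = L -> 0 <= g z0 + \sum_(i < m) g (z i)) ->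
  exists lam : R, forall x : R, 0 <= x <= L -> lam * (x * (x - c0)) <= Gam x.
Proof.
move=> c0 m1 L0 dG G0 g_ge0.
pose M := interval_mean Gam g 0.
have GE x : Gam x = x * M x.
  rewrite /M /interval_mean; case: eqP => [->|/eqP x0]; first by rewrite G0 mul0r.
  by rewrite add0r G0 subr0 mulrC divfK.
have N0 : 0 < m.+1%:R :> R by rewrite ltr0n.
have c00 : 0 < c0 by rewrite divr_gt0// mulr_gt0.
have N3 : 3 <= m.+1%:R :> R by rewrite ler_nat.
have c0L : c0 < L by rewrite ltr_pdivrMr//; nra.
have Nc0 : m.+1%:R * c0 = 2 * L by rewrite mulrC divfK// gt_eqF.
(* The degenerate chord: all intervals are [0, c0], whose midpoints sum to L. *)
have Mc0 : 0 <= M c0.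
  have sum_cst (x : R) : \sum_(i < m) x = x * (m.+1%:R - 1).
    by rewrite sumr_const card_ord -mulr_natr -natr1; ring.
  have := @uniform_block_mean_ge0 R Gam g m 0 c0 (fun=> 0) (fun=> c0) dG (lexx 0).
  rewrite add0r !sum_cst => H.
  rewrite -(pmulr_rge0 _ N0).
  have -> : m.+1%:R * M c0 = M c0 + M c0 * (m.+1%:R - 1) by ring.
  apply: H => [//|_|//|//|//|||z0 z z0_ge0 z_ge0 zE]; first exact: ltW.
  - exact: ltn_trans m1.
  - by rewrite ler_peMr; lra.
  - by apply: g_ge0 => //; rewrite zE; lra.
have chord_ge0 b c : 0 <= b < c0 -> c0 < c <= L -> 0 <= (c - c0) * M b + (c0 - b) * M c.
  move=> /andP[b0 bc0] /andP[c0c cL]; rewrite leNgt; apply/negP => neg.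
  have [b1 [c1 [w1 [[/andP[b10 b1c0] /andP[c0c1 c1L] /andP[w10 w11] E1] min1]]]] :=
    @min_chord_value R M c0 L (ltW c00) (ltW c0L)
      (fun x x0 => interval_mean_continuous dG (lt_le_trans (ltrN10 _) x0)).
  set mu := w1 * M b1 + (1 - w1) * M c1 in min1.
  have bc : 0 < c - b by lra.
  have mu0 : mu < 0.
    have : mu <= (c - c0) / (c - b) * M b + (1 - (c - c0) / (c - b)) * M c.
      apply: min1; split; rewrite ?b0 ?(ltW bc0) ?(ltW c0c) ?cL//.
        by rewrite divr_ge0 ?ler_pdivrMr//=; lra.
      by field; rewrite gt_eqF.
    move=> /le_lt_trans; apply.
    have -> : (c - c0) / (c - b) * M b + (1 - (c - c0) / (c - b)) * M c
       = ((c - c0) * M b + (c0 - b) * M c) / (c - b) by field; rewrite gt_eqF.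
    by rewrite pmulr_llt0// invr_gt0.
  have c0c1' : c0 < c1.
    rewrite lt_neqAle c0c1 andbT; apply/eqP => c1E.
    have : w1 * (b1 - c0) = 0 by move: E1; rewrite -c1E; lra.
    move/eqP; rewrite mulf_eq0 => /orP[/eqP w1E|].
      by move: mu0; rewrite /mu w1E -c1E; lra.
    by rewrite subr_eq0 => /eqP b1E; move: mu0; rewrite /mu b1E -c1E; lra.
  have b1c0' : b1 < c0.
    rewrite lt_neqAle b1c0 andbT; apply/eqP => b1E.
    have : (1 - w1) * (c1 - c0) = 0 by move: E1; rewrite b1E; lra.
    move/eqP; rewrite mulf_eq0 [c1 - c0 == 0]gt_eqF ?subr_gt0// orbF subr_eq0 => /eqP w1E.
    by move: mu0; rewrite /mu b1E -w1E; lra.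
  have bc1 : 0 < c1 - b1 by lra.
  pose lam := (M c1 - M b1) / (c1 - b1).
  have w1E : w1 = (c1 - c0) / (c1 - b1) by rewrite -E1; field; rewrite gt_eqF.
  have Mb1 : M b1 = mu + lam * (b1 - c0).
    by rewrite /mu w1E /lam; field; rewrite gt_eqF.
  have Mc1 : M c1 = mu + lam * (c1 - c0).
    by rewrite /mu w1E /lam; field; rewrite gt_eqF.
  suff : 0 <= mu by rewrite leNgt mu0.
  apply: (@affine_minorant_ge0 R Gam g m L mu lam b1 c1) => //; first by lra.
  move=> x /andP[x0 xL]; rewrite GE; apply: ler_wpM2l => //.
  have [xc0|c0x] := leP x c0.
    have d0 : 0 < c1 - x by lra.
    have : mu <= (c1 - c0) / (c1 - x) * M x + (1 - (c1 - c0) / (c1 - x)) * M c1.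
      apply: min1; split; rewrite ?x0 ?xc0 ?c0c1 ?c1L//.
        by rewrite divr_ge0 ?ler_pdivrMr//=; lra.
      by field; rewrite gt_eqF.
    have -> : (c1 - c0) / (c1 - x) * M x + (1 - (c1 - c0) / (c1 - x)) * M c1 =
       ((c1 - c0) * M x + (c0 - x) * M c1) / (c1 - x) by field; rewrite gt_eqF.
    rewrite ler_pdivlMr// Mc1 => H.
    have : 0 <= (c1 - c0) * (M x - (mu + lam * (x - c0))) by lra.
    by rewrite pmulr_rge0 ?subr_gt0// subr_ge0.
  have d0 : 0 < x - b1 by lra.
  have : mu <= (x - c0) / (x - b1) * M b1 + (1 - (x - c0) / (x - b1)) * M x.
    apply: min1; split; rewrite ?b10 ?b1c0 ?(ltW c0x) ?xL//.
      by rewrite divr_ge0 ?ler_pdivrMr//=; lra.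
    by field; rewrite gt_eqF.
  have -> : (x - c0) / (x - b1) * M b1 + (1 - (x - c0) / (x - b1)) * M x =
     ((x - c0) * M b1 + (c0 - b1) * M x) / (x - b1) by field; rewrite gt_eqF.
  rewrite ler_pdivlMr// Mb1 => H.
  have : 0 <= (c0 - b1) * (M x - (mu + lam * (x - c0))) by lra.
  by rewrite pmulr_rge0 ?subr_gt0// subr_ge0.
pose S := [set s | exists2 b, 0 <= b < c0 & s = - M b / (c0 - b)].
have S_ub c : c0 < c <= L -> ubound S (M c / (c - c0)).
  move=> cb _ [b bb ->]; have := chord_ge0 b c bb cb.
  move: cb bb => /andP[c0c cL] /andP[b0 bc0] H.
  rewrite ler_pdivrMr ?subr_gt0// mulrAC ler_pdivlMr ?subr_gt0//; lra.
have S0 : S !=set0 by exists (- M 0 / (c0 - 0)); exists 0 => //; rewrite lexx.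
have hS : has_sup S.
  by split => //; exists (M L / (L - c0)); apply: S_ub; rewrite c0L lexx.
exists (sup S) => x /andP[x0 xL]; rewrite GE mulrCA; apply: ler_wpM2l => //.
have [xc0|c0x|->] := ltgtP x c0; last by rewrite subrr mulr0.
- have := sup_upper_bound hS (x := - M x / (c0 - x)); rewrite ler_pdivrMr ?subr_gt0// => H.
  have : - M x <= sup S * (c0 - x) by apply: H; exists x => //; rewrite x0.
  lra.
- by rewrite -ler_pdivlMr ?subr_gt0//; apply: sup_le_ub => //; apply: S_ub; rewrite c0x.
Qed.

(** * The lower bound for continuous dual functions *)

(** One coordinate [t] and [k - 1] coordinates [1 - (k - 1) * t] have a sum of
    inverses that is smallest, for [t <= 1 / (k + y)], at the right end, where it
    is the left-hand side. *)
Lemma tail_sum_ge (R : realType) (k y t : R) : 2 < k -> k - 2 < y -> 0 < t -> t * (k + y) <= 1 ->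
  (k + y) ^+ 2 / (1 + y) <= t^-1 + (k - 1) / (1 - (k - 1) * t).
Proof.
move=> k2 ky t0 tle.
have ky0 : 0 < k + y by lra.
have y1 : 0 < 1 + y by lra.
have k1t : 2 * ((k - 1) * t) <= 1 by nra.
have d0 : 0 < 1 - (k - 1) * t by lra.
rewrite -subr_ge0.
have -> : t^-1 + (k - 1) / (1 - (k - 1) * t) - (k + y) ^+ 2 / (1 + y) =
  (1 - t * (k + y)) * ((1 + y) * (1 - (k - 1) * t) - (k - 1) ^+ 2 * t)
   / (t * (1 - (k - 1) * t) * (1 + y)).
  by field; repeat (apply/andP; split); rewrite gt_eqF.
apply: divr_ge0; last by rewrite !mulr_ge0 ?ltW.
apply: mulr_ge0; first by lra.
have : (k - 1) * (1 - (k - 1) * t) <= (1 + y) * (1 - (k - 1) * t).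
  by rewrite ler_pM2r//; lra.
have : (k - 1) * ((k - 1) * t) <= (k - 1) * (1 - (k - 1) * t).
  by rewrite ler_pM2l; lra.
rewrite expr2; lra.
Qed.

(** In the variable [z = 1 / u - A], [g] is the function [psi - 1 / k], and its
    weighted integral is to be bounded below by 0. An integration by parts
    expresses this integral by the primitive [G] with positive weights, so that
    [G] may be replaced by the quadratic [lam * z * (z - c0)]. What results is the
    increment of [S] over [[0, L]], and [S L = S 0] is the equation
    [excess k y = 0]. *)
Lemma mid_primitive_ge (R : realType) (psi Psi : R -> R) (m : nat) (y A : R) :
  let k : R := m.+1%:R in
  (1 < m)%N -> 0 < y -> excess k y = 0 -> 1 < A ->
  continuous psi -> (forall x : R, -1 < x -> is_derive x 1 Psi (psi x)) ->
  (forall (u0 : R) (u : nat -> R), 0 < u0 < 1 -> (forall i, 0 < u i < 1) ->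
     u0^-1 + \sum_(i < m) (u i)^-1 = A * (k + y) -> 1 <= psi u0 + \sum_(i < m) psi (u i)) ->
  (A^-1 - (A * (1 + y))^-1) / k <= Psi A^-1 - Psi (A * (1 + y))^-1.
Proof.
move=> k m1 y0 Ey A1 cpsi dPsi psi_ge.
have k3 : 3 <= k by rewrite ler_nat.
pose g (z : R) := psi (A + Num.max 0 z)^-1 - k^-1.
have max_gt0 (z : R) : 0 < A + Num.max 0 z.
  have : 0 <= Num.max 0 z by rewrite le_max lexx.
  lra.
have cg : continuous g.
  move=> z; apply: cvgB; last exact: cvg_cst.
  apply: continuous_comp; last exact: cpsi.
  apply: cvgV; first by rewrite gt_eqF.
  apply: cvgD; first exact: cvg_cst.
  by apply: continuous_max; [exact: cst_continuous|exact: cvg_id].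
have [G dG G_0] : exists2 G : R -> R,
    forall x : R, -1 < x -> is_derive x 1 G (g x) & G 0 = 0.
  have [G0 dG0] := antiderivative (-1) cg.
  exists (fun x => G0 x - G0 0) => [x x1|]; last by rewrite subrr.
  by have := dG0 x x1 => ?; derive_tac; ring.
pose L := y * A.
have L0 : 0 < L by apply: mulr_gt0; lra.
pose c0 := 2 * L / k.
have [|lam lamP] := @quadratic_minorant R G g m L m1 L0 dG G_0.
  move=> z0 z z0_ge0 z_ge0 zE.
  have AVE (x : R) : 0 <= x -> Num.max 0 x = x by move=> ?; rewrite max_r.
  have : 1 <= psi (A + z0)^-1 + \sum_(i < m) psi (A + z i)^-1.
    apply: (psi_ge _ (fun i => (A + z i)^-1)).
    - by rewrite invr_gt0 invf_lt1; lra.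
    - move=> i; have := z_ge0 i; move: (z i) => x x0.
      by rewrite invr_gt0 invf_lt1; lra.
    - rewrite invrK; under eq_bigr do rewrite invrK.
      rewrite big_split/= sumr_const card_ord -mulr_natr.
      have -> : k = m%:R + 1 by rewrite natr1.
      by rewrite addrACA zE /L; ring.
  have -> : \sum_(i < m) g (z i) = \sum_(i < m) psi (A + z i)^-1 - (1 - k^-1).
    under eq_bigr do rewrite /g AVE//.
    rewrite big_split/= sumr_const card_ord -[_ *+ m]mulr_natr.
    have -> : m%:R = k - 1 by rewrite /k -natr1; ring.
    by congr (_ + _); field; rewrite gt_eqF//; lra.
  rewrite /g AVE//; move: (psi _) (\sum_(i < m) _) k^-1 => p q r; lra.
rewrite -/c0 in lamP.
(* H collects the boundary terms of the integration by parts; its derivative is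
   the weight 2 / (A + z)^3 times the gap between G and the quadratic. *)
pose S (z : R) := lam * (2 * ln (A + z) + (2 * A + c0) / (A + z)).
pose H (z : R) := - Psi (A + z)^-1 - (G z - lam * (z * (z - c0))) / (A + z) ^+ 2
  + k^-1 / (A + z) - S z.
have dH (z : R) : 0 <= z <= L ->
    is_derive z 1 H (2 * (G z - lam * (z * (z - c0))) / (A + z) ^+ 3).
  move=> /andP[z0 zL].
  have Az0 : 0 < A + z by lra.
  have dGz : is_derive z 1 G (g z) by apply: dG; lra.
  have Azi : -1 < (A + z)^-1 by apply: lt_trans (ltrN10 _) _; rewrite invr_gt0.
  have dPz : is_derive z 1 (fun t => Psi (A + t)^-1)
      (psi (A + z)^-1 * (- ((A + z) ^- 2))).
    apply: is_derive_comp_real; first exact: dPsi.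
    by derive_tac; [rewrite gt_eqF|ring].
  have gz : psi (A + z)^-1 = g z + k^-1 by rewrite /g max_r// subrK.
  rewrite gz in dPz.
  rewrite /H /S; under eq_fun => t do rewrite expr2.
  derive_tac => //; rewrite ?mulf_neq0 ?gt_eqF//.
  by field; rewrite !gt_eqF//; lra.
have := @derive_ge_incr R H _ 0 L 0 (ltW L0) dH.
rewrite mul0r subr_ge0 => HL.
have {HL} : H 0 <= H L.
  apply: HL => z /andP[z0 zL]; apply: divr_ge0; last by rewrite exprn_ge0//; lra.
  by rewrite mulr_ge0// subr_ge0; apply: lamP; rewrite !ltW.
have SL : S L = S 0.
  rewrite /S; congr (_ * _); rewrite addr0.
  have -> : A + L = A * (1 + y) by rewrite /L; ring.
  rewrite lnM ?posrE; [|by lra|by lra].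
  move: Ey; rewrite /excess => /eqP; rewrite subr_eq0 => /eqP ->.
  by rewrite /c0 /L; field; repeat (apply/andP; split); rewrite gt_eqF; lra.
rewrite /H SL addr0 mul0r mulr0 G_0 subrr mul0r subr0.
have -> : A + L = A * (1 + y) by rewrite /L; ring.
have : 0 <= (G L - lam * (L * (L - c0))) / (A * (1 + y)) ^+ 2.
  rewrite divr_ge0 ?subr_ge0 ?exprn_ge0 ?mulr_ge0//; [|by lra|by lra].
  by apply: lamP; rewrite lexx ltW.
move: (_ / (A * (1 + y)) ^+ 2) (S 0) (Psi A^-1) (Psi _) => q s p1 p2.
by move: k^-1 A^-1 (A * (1 + y))^-1 => ? ? ?; lra.
Qed.

(** With [tau = 1 / (k + y)], integrate the constraint over the points
    [(e * t, e * (1 - (k - 1) * t), .., e * (1 - (k - 1) * t))] for [0 < t < tau].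
    The coordinates sweep out the two ends of [[0, e]] and leave the interval
    treated by [mid_primitive_ge]; the bounds for the parts add up to [e / k]. *)
Lemma continuous_dual_bound (R : realType) (psi Psi : R -> R) (m : nat) (y e : R) :
  let k : R := m.+1%:R in
  (1 < m)%N -> k - 2 < y -> excess k y = 0 -> 0 < e < 1 ->
  continuous psi -> (forall x : R, -1 < x -> is_derive x 1 Psi (psi x)) ->
  (forall x : R, 0 <= psi x) ->
  (forall (u0 : R) (u : nat -> R), 0 < u0 < 1 -> (forall i, 0 < u i < 1) ->
     (k + y) ^+ 2 / ((1 + y) * e) <= u0^-1 + \sum_(i < m) (u i)^-1 ->
     1 <= psi u0 + \sum_(i < m) psi (u i)) ->
  e <= k * (Psi 1 - Psi 0).
Proof.
move=> k m1 ky Ey /andP[e0 e1] cpsi dPsi psi0 psi_ge.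
have k3 : 3 <= k by rewrite ler_nat.
have sum_cst (x : R) : \sum_(i < m) x = x * (k - 1).
  by rewrite sumr_const card_ord -mulr_natr /k -natr1; ring.
have y0 : 0 < y by lra.
pose tau := (k + y)^-1.
have tau0 : 0 < tau by rewrite invr_gt0; lra.
have tauE : tau * (k + y) = 1 by rewrite mulVf// gt_eqF//; lra.
have tail : e * tau <= (Psi (e * tau) - Psi 0) + (Psi e - Psi (e * (1 - (k - 1) * tau))).
  have := @derive_ge_incr R (fun t => Psi (e * t) - Psi (e * (1 - (k - 1) * t)))
    (fun t => psi (e * t) * e + psi (e * (1 - (k - 1) * t)) * (e * (k - 1)))
    0 tau e (ltW tau0).
  rewrite !mulr0 !subr0 !mulr1 => H.
  suff : e * tau <= Psi (e * tau) - Psi (e * (1 - (k - 1) * tau)) - (Psi 0 - Psi e) by lra.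
  apply: H => t /andP[t0 tt].
    have kt : (k - 1) * t <= 1 by nra.
    have ? : is_derive t 1 (fun t => Psi (e * t)) (psi (e * t) * e).
      apply: is_derive_comp_real; last by derive_tac; ring.
      by apply: dPsi; nra.
    have ? : is_derive t 1 (fun t => Psi (e * (1 - (k - 1) * t)))
       (psi (e * (1 - (k - 1) * t)) * (- (e * (k - 1)))).
      apply: is_derive_comp_real; last by derive_tac; ring.
      by apply: dPsi; nra.
    by derive_tac; ring.
  have kt : (k - 1) * t < 1 by nra.
  have kt0 : 0 < (k - 1) * t by apply: mulr_gt0 => //; lra.
  have := @psi_ge (e * t) (fun=> e * (1 - (k - 1) * t)).
  rewrite !sum_cst => H.
  have {H} : 1 <= psi (e * t) + psi (e * (1 - (k - 1) * t)) * (k - 1).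
    apply: H => [|_|]; [by apply/andP; split; nra|by apply/andP; split; nra|].
    have := @tail_sum_ge R k y t; move=> /(_ ltac:(lra) ky t0 ltac:(nra)) H.
    have -> : (k + y) ^+ 2 / ((1 + y) * e) = (k + y) ^+ 2 / (1 + y) / e.
      by field; apply/andP; split; rewrite gt_eqF//; lra.
    rewrite ler_pdivrMr//; apply: le_trans H _.
    rewrite le_eqVlt; apply/orP; left; apply/eqP.
    by field; repeat (apply/andP; split); rewrite gt_eqF//; lra.
  nra.
pose A := (k + y) / ((1 + y) * e).
have A1 : 1 < A by rewrite ltr_pdivlMr; nra.
have := @mid_primitive_ge R psi Psi m y A m1 y0 Ey A1 cpsi dPsi.
rewrite -/k => H.
have {H} : (A^-1 - (A * (1 + y))^-1) / k <= Psi A^-1 - Psi (A * (1 + y))^-1.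
  apply: H => u0 u u0b ub uE; apply: psi_ge => //; rewrite uE.
  rewrite le_eqVlt; apply/orP; left; apply/eqP; rewrite /A.
  by field; apply/andP; split; rewrite gt_eqF//; lra.
have -> : (A * (1 + y))^-1 = e * tau.
  by rewrite /A /tau; field; repeat (apply/andP; split); rewrite gt_eqF//; lra.
have -> : A^-1 = e * (1 - (k - 1) * tau).
  by rewrite /A /tau; field; repeat (apply/andP; split); rewrite gt_eqF//; lra.
rewrite ler_pdivrMr; last by lra.
have : 0 <= Psi 1 - Psi e.
  have := @derive_ge_incr R Psi psi e 1 0 (ltW e1); rewrite mul0r; apply => [x|//].
  by move=> /andP[ex _]; apply: dPsi; lra.
have : e * tau * (k + y) = e by rewrite -mulrA tauE mulr1.
nra.
Qed.

(** * Duality for tuples of cells *)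

Lemma sum_indicator (R : realType) (I : finType) (x : I) (F : I -> R) :
  \sum_j (j == x)%:R * F j = F x.
Proof.
rewrite (bigD1 x)//= eqxx mul1r big1 ?addr0// => j /negbTE ->.
by rewrite mul0r.
Qed.

Lemma continuous_bigsum (R : realType) (T : topologicalType) (I : Type) (s : seq I)
    (F : I -> T -> R) : (forall i, continuous (F i)) ->
  continuous (fun x => \sum_(i <- s) F i x).
Proof.
move=> cF x; elim: s => [|i s IH].
  have -> : (fun x => \sum_(i <- [::]) F i x) = cst 0.
    by apply/funext => t; rewrite big_nil.
  exact: cst_continuous.
have -> : (fun x => \sum_(j <- i :: s) F j x) = (fun x => F i x + \sum_(j <- s) F j x).
  by apply/funext => t; rewrite big_cons.
exact: cvgD (cF i x) IH.
Qed.

Lemma probability_simplex_compact (R : realType) (n : nat) :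
  compact [set v : 'rV[R]_n | (forall i, 0 <= v ord0 i) /\ \sum_i v ord0 i = 1].
Proof.
have -> : [set v : 'rV[R]_n | (forall i, 0 <= v ord0 i) /\ \sum_i v ord0 i = 1] =
    [set v | forall i, `[0, 1]%classic (v ord0 i)] `&` [set v | \sum_i v ord0 i = 1].
  apply/seteqP; split=> v /= [v0 v1]; split => // i; last first.
    by have := v0 i; rewrite in_itv/= => /andP[].
  rewrite in_itv/= v0/= -v1 (bigD1 i)//= lerDl; exact: sumr_ge0.
apply: compact_closedI.
  by apply: (@rV_compact R^o n (fun=> `[0, 1]%classic)) => i; exact: segment_compact.
apply: (@preimage_closed _ _ (fun v : 'rV[R]_n => \sum_i v ord0 i) [set (1 : R)]) => [v _|].
  apply: (@continuous_bigsum _ _ _ _ (fun i (v : 'rV[R]_n) => v ord0 i)) => i.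
  exact: coord_continuous.
exact: closed_eq.
Qed.

(** Take the point of the convex hull of the [h i] nearest to [p], which exists
    since the weights range over a compact simplex. If it differs from [p], the
    difference [r] of the two separates: moving from the nearest point towards
    [h i] cannot decrease the distance to first order. *)
Lemma convex_hull_or_separated (R : realType) (I C : finType) (h : I -> C -> R)
    (p : C -> R) : (0 < #|I|)%N ->
  (exists W : I -> R, [/\ forall i, 0 <= W i, \sum_i W i = 1 &
      forall c, \sum_i W i * h i c = p c]) \/
  (exists f : C -> R, exists2 eta : R, 0 < eta &
      forall i, \sum_c f c * p c + eta <= \sum_c f c * h i c).
Proof.
move=> I0; set n := #|I| in I0.
pose S := [set v : 'rV[R]_n | (forall i, 0 <= v ord0 i) /\ \sum_i v ord0 i = 1].
pose q (v : 'rV[R]_n) c := \sum_(i < n) v ord0 i * h (enum_val i) c.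
pose D (v : 'rV[R]_n) := \sum_c (q v c - p c) ^+ 2.
have cq c : continuous (q ^~ c).
  apply: (@continuous_bigsum _ _ _ _ (fun i (v : 'rV[R]_n) => v ord0 i * h (enum_val i) c)) => i v.
  exact: cvgM (@coord_continuous R 1 n ord0 i v) (cvg_cst _).
have cD : continuous D.
  apply: (@continuous_bigsum _ _ _ _ (fun c (v : 'rV[R]_n) => (q v c - p c) ^+ 2)) => c v.
  have H : q w c - p c @[w --> v] --> q v c - p c by exact: cvgB (cq c v) (cvg_cst _).
  exact: (cvgM H H).
have S0 : S !=set0.
  exists (\row_i (i == Ordinal I0)%:R); split=> [i|]; first by rewrite mxE.
  under eq_bigr do rewrite mxE.
  by rewrite (bigD1 (Ordinal I0))//= ?eqxx big1 ?addr0// => i /negbTE ->.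
have [v] := EVT_min_rV S0 (@probability_simplex_compact R n) (continuous_subspaceT cD).
rewrite inE => -[v0 v1] vmin.
pose r c := q v c - p c.
have [r0|/existsNP[c0 rc0]] := pselect (forall c, r c = 0).
  left; exists (fun i => v ord0 (enum_rank i)); split => //.
  - rewrite -v1 [RHS](reindex enum_rank)//; apply: onW_bij; exact: enum_rank_bij.
  - move=> c; have /eqP := r0 c; rewrite subr_eq0 => /eqP <-.
    rewrite /q [RHS](reindex enum_rank)/=; last by apply: onW_bij; exact: enum_rank_bij.
    by apply: eq_bigr => i _; rewrite enum_rankK.
right; exists r, (\sum_c r c ^+ 2).
  rewrite (bigD1 c0)//= ltr_wpDr ?sumr_ge0// => [c _|]; first exact: sqr_ge0.
  by rewrite exprn_even_gt0//; exact/eqP.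
move=> i.
pose w c := h i c - q v c.
suff : 0 <= \sum_c r c * w c.
  have -> : \sum_c r c * p c + \sum_c r c ^+ 2 = \sum_c r c * q v c.
    by rewrite -big_split/=; apply: eq_bigr => c _; rewrite /r; ring.
  under eq_bigr do rewrite mulrBr.
  by rewrite sumrB subr_ge0.
set b := \sum_c r c * w c; pose a := \sum_c w c ^+ 2.
have a0 : 0 <= a by apply: sumr_ge0 => c _; exact: sqr_ge0.
(* The squared distance along the segment towards h i, minus its initial value. *)
have path s : 0 <= s <= 1 -> 0 <= s * (2 * b + s * a).
  move=> /andP[s0 s1].
  pose u : 'rV[R]_n := \row_j ((1 - s) * v ord0 j + s * (j == enum_rank i)%:R).
  have uS : S u.
    split=> [j|]; first by rewrite mxE addr_ge0 ?mulr_ge0 ?subr_ge0.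
    under eq_bigr do rewrite mxE.
    rewrite big_split/= -!mulr_sumr v1.
    under [X in _ + _ * X]eq_bigr do rewrite -[_%:R]mulr1.
    by rewrite sum_indicator; ring.
  have qu c : q u c - p c = r c + s * w c.
    rewrite /q; under eq_bigr do rewrite mxE mulrDl -!mulrA.
    rewrite big_split/= -!mulr_sumr -/(q v c) sum_indicator enum_rankK.
    by rewrite /r /w; ring.
  have := vmin u; rewrite inE => /(_ uS); rewrite -subr_ge0.
  rewrite /D -sumrB; under eq_bigr do rewrite qu.
  suff -> : \sum_c ((r c + s * w c) ^+ 2 - r c ^+ 2) = s * (2 * b + s * a) by [].
  rewrite /b /a !mulr_sumr -big_split/= mulr_sumr; apply: eq_bigr => c _; ring.
rewrite leNgt; apply/negP => b0.
pose s := - b / (a - b).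
have ab : 0 < a - b by lra.
have s0 : 0 < s by rewrite divr_gt0 ?oppr_gt0.
have s1 : s <= 1 by rewrite ler_pdivrMr//; lra.
have := path s; rewrite (ltW s0) s1 => /(_ isT); rewrite pmulr_rge0//.
have : s * a <= - b by rewrite mulrC mulrA ler_pdivrMr//; nra.
lra.
Qed.

(** The law [W] exists if the vector of marginals [1 / N] and of the good mass
    [tau] lies in the convex hull of those of single tuples; the boolean
    component of an index allows the mass of good tuples to be undercounted, so
    that only [tau <= ..] is asked for. Otherwise a functional separates them:
    functions [phi i j] of the coordinates and a coefficient [gam] of the good
    mass. Constant tuples show that [gam < 0], and that [psi] below is
    nonnegative. As good tuples are stable under cyclic shifts, averaging over the
    shifts replaces the [phi i] by their sum, which, normalised, is a dual
    function of too small a sum. *)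
Lemma discrete_coupling (R : realType) (m N : nat) (tau : R)
    (good : pred {ffun 'I_m.+1 -> 'I_N}) : (0 < N)%N -> 0 <= tau ->
  (forall t c, good t -> good [ffun i => t (i + c)]) ->
  (forall psi : 'I_N -> R, (forall j, 0 <= psi j) ->
     (forall t, good t -> 1 <= \sum_i psi (t i)) ->
     tau <= m.+1%:R / N%:R * \sum_j psi j) ->
  exists W : {ffun 'I_m.+1 -> 'I_N} -> R, [/\ forall t, 0 <= W t,
    \sum_t W t = 1, forall i j, \sum_(t : {ffun 'I_m.+1 -> 'I_N} | t i == j) W t = N%:R^-1 &
    tau <= \sum_(t | good t) W t].
Proof.
move=> N0 tau0 good_shift dual.
pose I : finType := ({ffun 'I_m.+1 -> 'I_N} * bool)%type.
pose C : finType := option ('I_m.+1 * 'I_N).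
pose h (x : I) (c : C) : R :=
  if c is Some (i, j) then (x.1 i == j)%:R else (x.2 && good x.1)%:R.
pose p (c : C) : R := if c is Some _ then N%:R^-1 else tau.
have NR0 : 0 < N%:R :> R by rewrite ltr0n.
have I0 : (0 < #|I|)%N.
  by apply/card_gt0P; exists ([ffun=> Ordinal N0], true).
have [[W [W0 W1 Wh]]|[f [eta eta0 sep]]] := convex_hull_or_separated h p I0.
  exists (fun t => W (t, true) + W (t, false)).
  have sumI (F : I -> R) : \sum_x F x = \sum_t (F (t, true) + F (t, false)).
    transitivity (\sum_t \sum_b F (t, b)).
      by rewrite pair_bigA/=; apply: eq_bigr => -[].
    by apply: eq_bigr => t _; rewrite big_bool.
  split=> [t||i j|]; first by rewrite addr_ge0.
  - by rewrite -sumI.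
  - have := Wh (Some (i, j)); rewrite sumI/= => <-; rewrite big_mkcond.
    by apply: eq_bigr => t _; case: eqP => _; rewrite ?mulr1 ?mulr0 ?addr0.
  - have := Wh None; rewrite sumI/= => <-; rewrite [leRHS]big_mkcond/=.
    apply: ler_sum => t _; rewrite mulr0 addr0.
    by case: (good t); rewrite ?mulr1 ?mulr0// lerDl.
exfalso.
have sum_cst n (x : R) : \sum_(j < n) x = n%:R * x.
  by rewrite sumr_const card_ord mulr_natl.
pose phi (i : 'I_m.+1) (j : 'I_N) := f (Some (i, j)); pose gam := f None.
pose mean := (\sum_i \sum_j phi i j) / N%:R.
have sepE (t : {ffun 'I_m.+1 -> 'I_N}) (b : bool) : mean + gam * tau + eta <= \sum_i phi i (t i) + gam * (b && good t)%:R.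
  have := sep (t, b).
  have sumC (F : C -> R) : \sum_c F c = \sum_i \sum_j F (Some (i, j)) + F None.
    rewrite (bigD1 None)//= addrC; congr (_ + _).
    rewrite (reindex_omap Some id)/=; last by case.
    rewrite (eq_bigl predT) => [|x]; last by rewrite eqxx.
    by rewrite pair_bigA/=; apply: eq_bigr => -[].
  rewrite !sumC /mean mulr_suml.
  under eq_bigr do rewrite -mulr_suml.
  move=> /le_trans; apply; rewrite lerD2r; apply: ler_sum => i _.
  rewrite le_eqVlt; apply/orP; left; apply/eqP.
  rewrite -[RHS](sum_indicator (t i) (phi i)); apply: eq_bigr => j _.
  by rewrite mulrC eq_sym.
have sum_diag : \sum_(j < N) \sum_i phi i j = N%:R * mean.
  by rewrite exchange_big/= /mean mulrC divfK ?gt_eqF.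
have gam_lt0 : gam * tau <= - eta.
  have : \sum_(j < N) (mean + gam * tau + eta) <= \sum_(j < N) \sum_i phi i j.
    apply: ler_sum => j _; have := sepE [ffun=> j] false; rewrite /= mulr0 addr0.
    by under eq_bigr do rewrite ffunE.
  rewrite sum_diag sum_cst ler_pM2l//; lra.
have gam0 : gam < 0.
  by rewrite ltNge; apply/negP => g0; have := mulr_ge0 g0 tau0; lra.
pose rho := - gam; have rho0 : 0 < rho by rewrite oppr_gt0.
pose K : R := m.+1%:R; have K0 : 0 < K by rewrite ltr0n.
pose kap := mean + gam * tau + eta.
pose psi (j : 'I_N) := (\sum_i phi i j - kap) / (K * rho).
have psi0 j : 0 <= psi j.
  rewrite divr_ge0 ?mulr_ge0 ?(ltW rho0) ?(ltW K0)// subr_ge0.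
  have := sepE [ffun=> j] false; rewrite /= mulr0 addr0.
  by under eq_bigr do rewrite ffunE.
have psi1 t : good t -> 1 <= \sum_i psi (t i).
  move=> gt; rewrite -mulr_suml ler_pdivlMr ?mulr_gt0// mul1r.
  have : \sum_(c < m.+1) rho <= \sum_(c < m.+1) (\sum_i phi i (t (i + c)) - kap).
    apply: ler_sum => c _; have := sepE [ffun i => t (i + c)] true.
    rewrite good_shift// mulr1.
    under eq_bigr do rewrite ffunE.
    rewrite -/kap /rho; lra.
  rewrite sum_cst -/K => /le_trans; apply.
  rewrite !sumrB lerD2r exchange_big [leRHS]exchange_big/=.
  rewrite le_eqVlt; apply/orP; left; apply/eqP; apply: eq_bigr => i _.
  rewrite [RHS](reindex_inj (addrI i))//=.
have := dual psi psi0 psi1.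
rewrite -mulr_suml sumrB sum_diag sum_cst.
have -> : m.+1%:R / N%:R * ((N%:R * mean - N%:R * kap) / (K * rho)) = (mean - kap) / rho.
  by rewrite -/K; field; repeat (apply/andP; split); rewrite gt_eqF.
rewrite ler_pdivlMr// /kap /rho; lra.
Qed.

(** * Uniform variables on an atomless space *)

Lemma uniform_prob_lt (R : realType) (x : R) : 0 <= x <= 1 ->
  uniform_prob (@ltr01 R) `]-oo, x[ = x%:E.
Proof.
move=> /andP[x0 x1]; rewrite /uniform_prob integral_uniform_pdf.
have -> : `]-oo, x[ `&` `[0, 1] = `[0, x[%classic :> set R.
  apply/seteqP; split=> t /=; rewrite !in_itv/=.
    by move=> [-> /andP[->]].
  by move=> /andP[t0 tx]; rewrite tx t0/= ltW// (lt_le_trans tx).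
rewrite (eq_integral (fun=> 1%:E)); last first.
  move=> t; rewrite inE/= in_itv/= => /andP[t0 tx].
  by rewrite /uniform_pdf t0 (ltW (lt_le_trans tx x1))/= subr0 invr1.
rewrite integral_cst//= mul1e lebesgue_measure_itv/= lte_fin.
case: ltP => [_|x_le0]; first by rewrite oppr0 adde0.
by congr EFin; apply/eqP; rewrite eq_le x0 x_le0.
Qed.

(** [uniform_prob] lives on another copy of the real line than [distribution];
    pushing forward by this identity moves it. *)
Definition borel_id (R : realType) : measurableTypeR R -> R := idfun.
HB.instance Definition _ (R : realType) := @isMeasurableFun.Build _ _ _ _ (@borel_id R)
  (@measurable_id _ (measurableTypeR R) setT).

Lemma uniform01_cdf (d : measure_display) (T : measurableType d) (R : realType)
    (P : probability T R) (U : {RV P >-> R}) :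
  (forall t, 0 <= U t <= 1) ->
  (forall x : R, 0 <= x <= 1 -> P [set t | U t < x] = x%:E) -> uniform01 P U.
Proof.
move=> U01 Ux; split => // A mA.
pose m1 : {measure set R -> \bar R} := distribution P U.
pose m2 : {measure set R -> \bar R} := distribution (uniform_prob (@ltr01 R)) (@borel_id R).
refine (@measure_unique _ R _ (@measurable_realfun.RGenInftyO.G R)
  (fun n : nat => `]-oo, (n%:R : R)[%classic) _ _ _ _ m1 m2 _ _ A mA).
- exact: measurable_realfun.RGenInftyO.measurableE.
- move=> _ _ [x ->] [y ->]; exists (Num.min x y).
  by apply/seteqP; split=> t /=; rewrite !in_itv/= lt_min => /andP.
- by move=> n; exists n%:R.
- apply/seteqP; split => // x _; exists (Num.truncn (x : R)).+1 => //=; rewrite in_itv/=.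
  exact: truncnS_gt.
- move=> _ [x ->]; rewrite -[m2 _]/(uniform_prob (@ltr01 R) `]-oo, x[%classic).
  have -> : m1 `]-oo, x[%classic = P [set t | U t < x].
    by congr (P _); apply/seteqP; split=> t /=; rewrite in_itv.
  have [x0|x0] := ltP x 0.
    rewrite (_ : [set t | U t < x] = set0); last first.
      apply/seteqP; split=> t //= Utx; have /andP[Ut0 _] := U01 t.
      by have := le_lt_trans Ut0 (lt_trans Utx x0); rewrite ltxx.
    rewrite measure0; apply/esym/eqP; rewrite eq_le measure_ge0 andbT.
    have H0 : 0 <= (0 : R) <= 1 by rewrite lexx ler01.
    rewrite -[leRHS](uniform_prob_lt H0); apply: le_measure; rewrite ?inE//.
    by apply: subset_itvl; rewrite bnd_simp ltW.
  have [x1|x1] := leP x 1; first by rewrite uniform_prob_lt ?x0// Ux// x0.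
  have H1 : 0 <= (1 : R) <= 1 by rewrite lexx ler01.
  have mU y : measurable [set t | U t < y].
    rewrite (_ : [set t | U t < y] = U @^-1` `]-oo, y[); first exact: measurable_funPTI.
    by apply/seteqP; split=> t /=; rewrite in_itv.
  transitivity (1%:E : \bar R); apply/eqP; rewrite eq_le; apply/andP; split.
  + by apply: probability_le1; exact: mU.
  + rewrite -(Ux 1 H1); apply: le_measure; rewrite ?inE//.
    by move=> t /= /lt_trans; apply.
  + rewrite -(uniform_prob_lt H1); apply: le_measure; rewrite ?inE//.
    by apply: subset_itvl; rewrite bnd_simp ltW.
  + exact: probability_le1.
- move=> n; apply: le_lt_trans (probability_le1 _ _) (ltry _).
  exact: measurable_itv.
Qed.

Section measure_chain.
Context (d : measure_display) (T : measurableType d) (R : realType)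
  (P : probability T R).

(** Injectivity of [P] on the chain makes its order by inclusion an order by
    probability: an event of larger probability contains one of smaller or equal
    probability, without exceptional null sets. *)
Definition strict_chain (C : set (set T)) :=
  [/\ C `<=` measurable, total_on C subset &
      forall A B, C A -> C B -> P A = P B -> A = B].

Lemma strict_chain_bigcup (F : set (set (set T))) :
  F `<=` strict_chain -> total_on F subset -> strict_chain (\bigcup_(C in F) C).
Proof.
move=> FC Ftot.
have common A B : (\bigcup_(C in F) C) A -> (\bigcup_(C in F) C) B ->
    exists C, [/\ F C, C A & C B].
  move=> [C1 FC1 C1A] [C2 FC2 C2B]; have [C12|C21] := Ftot _ _ FC1 FC2.
    by exists C2; split => //; exact: C12.
  by exists C1; split => //; exact: C21.
split=> [A [C FCC CA]|A B UA UB|A B UA UB PAB].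
- by have [+ _ _] := FC _ FCC; apply.
- by have [C [/FC[_ + _] CA CB]] := common _ _ UA UB; apply.
- by have [C [/FC[_ _ +] CA CB]] := common _ _ UA UB; apply.
Qed.

Lemma strict_chain_saturated : exists2 C : set (set T), strict_chain C &
  forall X, measurable X -> (forall A, C A -> A `<=` X \/ X `<=` A) ->
    exists2 A, C A & P A = P X.
Proof.
have [C [chC maxC]] := Zorn_bigcup strict_chain_bigcup.
exists C => // X mX cmpX; have [mC totC injC] := chC.
apply: contrapT => noA.
have nA A : C A -> P A <> P X by move=> CA PAX; apply: noA; exists A.
apply: (maxC (C `|` [set X])).
  split; first by move=> A CA; left.
  by move=> /(_ X (or_intror erefl)) CX; exact: (nA X).
split=> [A [/mC//|->//]|A B [CA|->] [CB|->]|A B [CA|->] [CB|->]] //.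
- exact: totC.
- exact: cmpX.
- by case: (cmpX _ CB); [right|left].
- by left.
- exact: injC.
- by move/nA => /(_ CA).
- by move/esym/nA => /(_ CB).
Qed.

(** The values below [x] are approached by an increasing sequence of events. The
    event of [D] with the probability of their union has a value at most [x] and
    different from [x], so it is the largest below [x]. *)
Lemma chain_largest_below (D : set (set T)) (x : R) :
  D `<=` measurable -> total_on D subset ->
  (forall F : nat -> set T, (forall n, D (F n)) ->
     exists2 A, D A & P A = P (\bigcup_n F n)) ->
  (exists2 A, D A & (P A < x%:E)%E) -> (forall A, D A -> P A <> x%:E) ->
  exists L, [/\ D L, (P L < x%:E)%E &
    forall A, D A -> (P A < x%:E)%E -> (P A <= P L)%E].
Proof.
move=> mD totD supD [A0 DA0 PA0] Dx.
have finP A : D A -> P A \is a fin_num by move=> /mD mA; exact: fin_num_measure.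
pose S := [set fine (P A) | A in [set A | D A /\ (P A < x%:E)%E]].
have hS : has_sup S.
  split; first by exists (fine (P A0)), A0.
  exists x => _ [A [DA PA] <-].
  by rewrite -lee_fin fineK ?finP// ltW.
have adh n : exists A, [/\ D A, (P A < x%:E)%E & sup S - n.+1%:R^-1 < fine (P A)].
  have [|_ [A [DA PA] <-] H] := sup_adherent (eps := n.+1%:R^-1) _ hS.
    by rewrite invr_gt0.
  by exists A.
have [F FP] := choice adh.
pose G := fix G n := if n is n'.+1 then G n' `|` F n'.+1 else F 0%N.
have GP n : D (G n) /\ (P (G n) < x%:E)%E.
  elim: n => [|n [DG PG]] /=; first by have [] := FP 0%N.
  have [DF PF _] := FP n.+1.
  by have [/setUidPr ->|/setUidPl ->] := totD _ _ DG DF.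
have [L DL PL] := supD G (fun n => (GP n).1).
have mG n : measurable (G n) by apply: mD; have [] := GP n.
have mUG : measurable (\bigcup_n G n) by exact: bigcup_measurable.
have ndG : nondecreasing_seq G.
  by apply/nondecreasing_seqP => n; apply/subsetPset => t /=; left.
have PLx : (P L <= x%:E)%E.
  rewrite PL; have cvgG := nondecreasing_cvg_mu (mu := P) mG mUG ndG.
  rewrite -(cvg_lim (@ereal_hausdorff R) cvgG)//; apply: lime_le; first by apply/cvg_ex; eexists; exact: cvgG.
  by near=> n; apply: ltW; have [] := GP n.
exists L; split => //.
  by rewrite lt_neqAle PLx andbT; apply/eqP; exact: Dx.
move=> A DA PA; rewrite -(fineK (finP _ DA)) -(fineK (finP _ DL)) lee_fin.
apply: (@le_trans _ _ (sup S)).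
  by apply: sup_upper_bound => //; exists A.
apply/ler_addgt0Pl => e e0.
have [n] : exists n : nat, n.+1%:R^-1 < e.
  by have [n _ Hn] := near_infty_natSinv_lt (PosNum e0); exists n; exact: (Hn n (leqnn n)).
move=> ne; have [DF PF FS] := FP n.
have : fine (P (F n)) <= fine (P L).
  rewrite fine_le ?finP// PL; apply: le_measure; rewrite ?inE//; first exact: mD.
  by apply: subset_trans (bigcup_sup (_ : setT n)) => //; case: (n) => //= n'; right.
by move: ne FS; move: n.+1%:R^-1 => i; lra.
Unshelve. all: by end_near. Qed.

(** If the value [x] is missing, there are a largest event [L] of the chain below
    [x] and, passing to complements, a smallest event [U] above [x]. The set
    [U `\` L] has positive probability, so it splits properly because [P] is
    atomless; adding a piece to [L] gives an event comparable to the whole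
    chain, with a value strictly between those of [L] and [U], against the
    saturation. *)
Lemma chain_attains (C : set (set T)) : atomless P -> strict_chain C ->
  (forall X, measurable X -> (forall A, C A -> A `<=` X \/ X `<=` A) ->
    exists2 A, C A & P A = P X) ->
  forall x : R, 0 <= x <= 1 -> exists2 A, C A & P A = x%:E.
Proof.
move=> hP [mC totC injC] sat x /andP[x0 x1]; apply: contrapT => nox.
have nx A : C A -> P A <> x%:E by move=> CA PA; apply: nox; exists A.
have finP A : measurable A -> P A \is a fin_num by move=> mA; exact: fin_num_measure.
have [A0 CA0] := sat set0 measurable0 (fun A _ => or_intror (@sub0set _ A)).
rewrite measure0 => PA0.
have [A1 CA1] := sat setT measurableT (fun A _ => or_introl (@subsetT _ A)).
rewrite probability_setT => PA1.
have {x0}x_gt0 : 0 < x.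
  by rewrite lt_neqAle x0 andbT; apply/eqP => xE; apply: (nx _ CA0); rewrite PA0 -xE.
have {x1}x_lt1 : x < 1.
  by rewrite lt_neqAle x1 andbT; apply/eqP => xE; apply: (nx _ CA1); rewrite PA1 xE.
have supC (F : nat -> set T) : (forall n, C (F n)) -> exists2 A, C A & P A = P (\bigcup_n F n).
  move=> CF; apply: sat; first by apply: bigcup_measurable => n _; exact: mC.
  move=> A CA; have [FA|/existsNP[n nFA]] := pselect (forall n, F n `<=` A).
    by right=> t [n _ Fnt]; exact: (FA n).
  left; have [AF|//] := totC _ _ CA (CF n).
  by apply: subset_trans AF _; exact: bigcup_sup.
have infC (F : nat -> set T) : (forall n, C (F n)) -> exists2 A, C A & P A = P (\bigcap_n F n).
  move=> CF; apply: sat; first by apply: bigcapT_measurable => n; exact: mC.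
  move=> A CA; have [AF|/existsNP[n nAF]] := pselect (forall n, A `<=` F n).
    by left=> t At n _; exact: (AF n).
  right; have [//|FA] := totC _ _ CA (CF n).
  by move=> t /(_ n I) /FA.
have [L [CL PL maxL]] : exists L, [/\ C L, (P L < x%:E)%E &
    forall A, C A -> (P A < x%:E)%E -> (P A <= P L)%E].
  by apply: chain_largest_below => //; exists A0; rewrite ?PA0 ?lte_fin.
have mL := mC _ CL.
pose p A := fine (P A).
have pE A : measurable A -> P A = (p A)%:E by move=> mA; rewrite /p fineK ?finP.
have pC A : measurable A -> p (~` A) = 1 - p A.
  by move=> mA; rewrite /p probability_setC// pE.
have pS A B : measurable A -> measurable B -> A `<=` B -> p A <= p B.
  by move=> mA mB AB; rewrite fine_le ?finP//; apply: le_measure; rewrite ?inE.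
have [U [CU PU minU]] : exists U, [/\ C U, x < p U &
    forall A, C A -> x < p A -> p U <= p A].
  have mD : [set A | C (~` A)] `<=` measurable.
    by move=> A /mC /measurableC; rewrite setCK.
  have [||||U' [CU' PU' maxU']] := @chain_largest_below [set A | C (~` A)] (1 - x) mD.
  - by move=> A B CA CB; have [/subsetC|/subsetC] := totC _ _ CA CB;
      rewrite !setCK; [right|left].
  - move=> F CF; have [A CA PA] := infC _ CF.
    have mF n : measurable (F n) by apply: mD; exact: CF.
    exists (~` A); first by rewrite /= setCK.
    rewrite probability_setC ?PA; last exact: mC.
    have mUF : measurable (\bigcup_n F n) by exact: bigcupT_measurable.
    rewrite -setC_bigcup !pE//; last exact: measurableC.
    by rewrite pC// -EFinB; congr EFin; ring.
  - exists (~` A1); first by rewrite /= setCK.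
    have mA1 := mC _ CA1.
    by rewrite pE ?pC ?lte_fin//; [rewrite /p PA1/= subrr; lra|exact: measurableC].
  - move=> A CA; have mA := mD A CA; rewrite pE// => -[] pA; apply: (nx _ CA).
    by rewrite pE ?pC ?pA//; [congr EFin; ring|exact: measurableC].
  have mU' : measurable U' by exact: mD.
  exists (~` U'); split => //; first by move: PU'; rewrite pE// lte_fin pC//; lra.
  move=> A CA xA; have mA := mC _ CA.
  have := maxU' (~` A); rewrite /= setCK => /(_ CA).
  by rewrite !pE ?lte_fin ?lee_fin ?pC//; [move=> H; have := H ltac:(lra); lra|exact: measurableC..].
have mU := mC _ CU.
rewrite pE// lte_fin in PL.
have {}maxL A : C A -> p A < x -> p A <= p L.
  by move=> CA pA; have := maxL A CA; rewrite !pE ?lte_fin ?lee_fin//; [apply|exact: mC].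
have eqP' A B : C A -> C B -> A `<=` B -> p B <= p A -> A = B.
  move=> CA CB AB pBA; apply: injC => //; rewrite !pE; [|exact: mC|exact: mC].
  by congr EFin; apply/eqP; rewrite eq_le pBA pS//; exact: mC.
have LU : L `<=` U.
  by have [//|UL] := totC _ _ CL CU; have := pS _ _ mU mL UL; lra.
have PUL : P (U `\` L) = (p U - p L)%:E.
  have mUL : measurable (U `\` L) by exact: measurableD.
  have UL : P U = (P (U `\` L) + P L)%E.
    by rewrite -(measureU P mUL mL) ?setDKU ?setDKI.
  by move: UL; rewrite !pE// -EFinD => -[->]; congr EFin; ring.
have [|B [mB BUL PB0 PBlt]] := hP (U `\` L) (measurableD mU mL).
  by rewrite PUL lte_fin; lra.
rewrite PUL pE// lte_fin in PB0 PBlt; rewrite lte_fin in PBlt.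
have mX : measurable (L `|` B) by exact: measurableU.
have pX : p (L `|` B) = p L + p B.
  have LB0 : L `&` B = set0 by apply/seteqP; split => // t [Lt /BUL[]].
  have : P (L `|` B) = (P L + P B)%E by exact: measureU.
  by rewrite !pE// -EFinD => -[].
have XU : L `|` B `<=` U by move=> t [/LU//|/BUL[]].
have [A CA] : exists2 A, C A & P A = P (L `|` B).
  apply: sat => // A CA; have [Ax|xA|Ax] := ltgtP (p A) x.
  - left; apply: subset_trans (@subsetUl _ _ _).
    have [//|LA] := totC _ _ CA CL.
    by rewrite (eqP' _ _ CL CA LA (maxL _ CA Ax)).
  - right; apply: subset_trans XU _.
    have [//|AU] := totC _ _ CU CA.
    by rewrite (eqP' _ _ CA CU AU (minU _ CA xA)).
  - by exfalso; apply: (nx _ CA); rewrite pE ?Ax//; exact: mC.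
rewrite !pE ?pX//; last exact: mC.
move=> [pA]; have [Ax|xA|Ax] := ltgtP (p A) x.
- by have := maxL _ CA Ax; lra.
- by have := minU _ CA xA; lra.
- by apply: (nx _ CA); rewrite pE ?Ax//; exact: mC.
Qed.

End measure_chain.

Lemma measurable_fun_lt (d : measure_display) (T : measurableType d) (R : realType)
    (f : T -> R) : (forall y : R, measurable [set t | f t < y]) ->
  measurable_fun setT f.
Proof.
move=> mf; apply: (measurability _ (measurable_realfun.RGenInftyO.measurableE R)).
move=> _ [_ [y ->] <-]; rewrite setTI.
rewrite (_ : _ @^-1` _ = [set t | f t < y]); first exact: mf.
by apply/seteqP; split=> t /=; rewrite in_itv.
Qed.

(** A saturated chain contains an event of each probability in [[0, 1]]. The
    variable [V t] is the infimum of the probabilities of the events of the chain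
    that contain [t]; thus [V < x] is, up to a null set, the event of probability
    [x]. *)
Lemma exists_uniform (d : measure_display) (T : measurableType d) (R : realType)
    (P : probability T R) : atomless P ->
  exists V : T -> R, [/\ forall t, 0 <= V t <= 1,
    forall y : R, measurable [set t | V t < y] &
    forall x : R, 0 <= x <= 1 -> P [set t | V t < x] = x%:E].
Proof.
move=> hP; have [C chC satC] := @strict_chain_saturated d T R P.
have attain := chain_attains hP chC satC; have [mC totC injC] := chC.
pose p A := fine (P A).
have pE A : measurable A -> P A = (p A)%:E.
  by move=> mA; rewrite /p fineK// fin_num_measure.
have pS A B : measurable A -> measurable B -> A `<=` B -> p A <= p B.
  by move=> mA mB AB; rewrite fine_le ?fin_num_measure//; apply: le_measure; rewrite ?inE.
have [|b bP] := @choice R (set T) (fun x A => 0 <= x <= 1 -> C A /\ p A = x).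
  move=> x; have [x01|nx] := pselect (0 <= x <= 1); last by exists set0 => /nx.
  by have [A CA PA] := attain x x01; exists A; rewrite /p PA.
pose S t := [set p B | B in [set B | C B /\ B t]] `|` [set 1].
have S_lb t : lbound (S t) 0.
  move=> _ [[B [CB _] <-]|->//]; exact: fine_ge0.
have hS t : has_inf (S t) by split; [exists 1; right|exists 0].
pose V t := inf (S t).
have V01 t : 0 <= V t <= 1.
  rewrite lb_le_inf//=; last by have [] := hS t.
  by apply: ge_inf; [exists 0|right].
have Vlt t (y : R) : y <= 1 -> V t < y -> exists B, [/\ C B, B t & p B < y].
  move=> y1 /(inf_lt (hS t).1) [_ [[B [CB Bt] <-]|->]]; first by exists B.
  by rewrite ltNge y1.
have Vle t B : C B -> B t -> V t <= p B.
  by move=> CB Bt; apply: ge_inf; [exists 0|left; exists B].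
have dec (y : R) n : 0 < y -> y <= 1 -> 0 <= y - y / n.+1%:R <= 1.
  move=> y0 y1.
  have : y / n.+1%:R <= y by rewrite ler_pdivrMr// ler_peMr ?ler1n// ltW.
  have : 0 < y / n.+1%:R by rewrite divr_gt0.
  by move: (y / _) => q q0 qy; apply/andP; split; lra.
have below (y : R) : 0 < y <= 1 -> [set t | V t < y] = \bigcup_n b (y - y / n.+1%:R).
  move=> /andP[y0 y1].
  have yn n := dec y n y0 y1.
  apply/seteqP; split=> [t /= Vty|t [n _ bt]] /=; last first.
    have [Cb pb] := bP _ (yn n); apply: le_lt_trans (Vle _ _ Cb bt) _.
    by rewrite pb ltrBlDr ltrDl divr_gt0.
  have [B [CB Bt pB]] := Vlt _ _ y1 Vty.
  have e0 : 0 < (y - p B) / y by rewrite divr_gt0// subr_gt0.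
  have [n _ /(_ n (leqnn n)) /= Hn] := near_infty_natSinv_lt (PosNum e0).
  exists n => //; have [Cb pb] := bP _ (yn n).
  have [Bb|bB] := totC _ _ CB Cb; first exact: Bb.
  have := pS _ _ (mC _ Cb) (mC _ CB) bB; rewrite pb.
  move: Hn; rewrite ltr_pdivlMr// mulrC; move: (y / _) => ?; lra.
have mbelow y : measurable [set t | V t < y].
  have [y0|y0] := leP y 0.
    rewrite (_ : [set t | _] = set0)//; apply/seteqP; split => // t /= Vy.
    by have /andP[V0 _] := V01 t; lra.
  have [y1|y1] := leP y 1.
    rewrite below ?y0//; apply: bigcupT_measurable => n; apply: mC.
    by apply: (bP _ _).1; exact: dec.
  rewrite (_ : [set t | _] = setT)//; apply/seteqP; split => // t _ /=.
  by have /andP[_ V1] := V01 t; lra.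
exists V; split => // x /andP[x0 x1].
have : 0 <= x by []. rewrite le_eqVlt => /predU1P[<-|{}x0].
  rewrite (_ : [set t | _] = set0) ?measure0//; apply/seteqP; split => // t /= Vy.
  by have /andP[V0 _] := V01 t; lra.
rewrite pE//; congr EFin; apply/eqP; rewrite eq_le; apply/andP; split.
  have [Cb pb] := bP x ltac:(rewrite (ltW x0) x1//); rewrite -[leRHS]pb.
  apply: (pS) => //; first exact: mC.
  move=> t /(Vlt _ _ x1)[B [CB Bt pB]].
  have [Bb|bB] := totC _ _ CB Cb; first exact: Bb.
  by have := pS _ _ (mC _ Cb) (mC _ CB) bB; rewrite pb; lra.
apply/ler_addgt0Pl => e e0.
pose z := Num.max 0 (x - e).
have z01 : 0 <= z <= 1 by rewrite le_max lexx/= ge_max ler01/=; lra.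
have [Cz pz] := bP z z01.
have : z <= p [set t | V t < x].
  rewrite -pz; apply: (pS) => //; first exact: mC.
  move=> t bt /=; apply: le_lt_trans (Vle _ _ Cz bt) _.
  by rewrite pz gt_max x0/=; lra.
have : x - e <= z by rewrite le_max lexx orbT.
lra.
Qed.

Definition clamp01 (R : realType) (z : R) : R := Num.max 0 (Num.min 1 z).

Lemma clamp01_bounds (R : realType) (z : R) : 0 <= clamp01 z <= 1.
Proof. by rewrite le_max lexx/= ge_max ler01/= ge_min lexx. Qed.

Lemma clamp01_gt (R : realType) (z w : R) : 0 <= w -> w < 1 ->
  (w < clamp01 z) = (w < z).
Proof. by move=> w0 w1; rewrite lt_max lt_min w1/= ltNge w0. Qed.

(** The lengths of the parts of [[0, z]] in the cells [[j, j + 1]]. *)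
Lemma sum_clamp01 (R : realType) (N : nat) (z : R) : 0 <= z <= N%:R ->
  \sum_(j < N) clamp01 (z - j%:R) = z.
Proof.
move=> /andP[z0 zN].
suff -> : \sum_(j < N) clamp01 (z - j%:R) = Num.min z N%:R by apply/min_idPl.
elim: N {zN} => [|N IH]; first by rewrite big_ord0; apply/esym/min_idPr.
rewrite big_ord_recr/= IH -natr1 /clamp01.
have [zN|Nz] := leP z N%:R.
  rewrite (min_idPr _); last by lra.
  rewrite (max_idPl _); last by lra.
  by rewrite addr0; apply/esym/min_idPl; lra.
have [zN|Nz'] := leP z (N%:R + 1).
  rewrite (min_idPr _); last by lra.
  by rewrite (max_idPr _); lra.
rewrite (min_idPl _); last by lra.
by rewrite (max_idPr _).
Qed.

Lemma in_bigsetU (T : Type) (I : finType) (A : pred I) (F : I -> set T) (t : T) :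
  (\big[setU/set0]_(i | A i) F i) t <-> exists2 i, A i & F i t.
Proof.
split; last by move=> [i Ai Fit]; rewrite (bigD1 i)//=; left.
by elim/big_rec: _ => // i X Ai IH [Fit|/IH//]; exists i.
Qed.

(** Given weights [W h] of tuples of cells, whose [i]-th cell is [cell i h], cut
    [[0, 1]] into consecutive blocks of lengths [W h], the [h]-th one starting at
    [s h]. Where [V] is in block [h], let [U i] run linearly through the cell
    [cell i h]. The marginal condition on [W] makes each [U i] uniform. *)
Section weighted_coupling.
Context (d : measure_display) (T : measurableType d) (R : realType)
  (P : probability T R).
Variables (V : T -> R) (M N : nat) (I : Type) (W : nat -> R) (cell : I -> 'I_M -> 'I_N).

Let s n := \sum_(0 <= j < n) W j.

(** The initial part of block [h], of relative length [k]. *)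
Let block (h : nat) (k : R) := [set t | s h <= V t < s h + W h * k].

(** Outside all blocks, an event of probability 0, the value is immaterial. *)
Let U (i : I) (t : T) : R :=
  if [pick h : 'I_M | s h <= V t < s h + W h] is Some h
  then ((cell i h)%:R + (V t - s h) / W h) / N%:R else 1.

Hypothesis N0 : (0 < N)%N.
Hypothesis mV : forall y : R, measurable [set t | V t < y].
Hypothesis PV : forall x : R, 0 <= x <= 1 -> P [set t | V t < x] = x%:E.
Hypothesis W0 : forall n, 0 <= W n.
Hypothesis W1 : \sum_(h < M) W h = 1.
Hypothesis Wcell : forall i j, \sum_(h < M | cell i h == j) W h = N%:R^-1.

Let sS n : s n.+1 = s n + W n.
Proof. by rewrite /s big_nat_recr. Qed.

Let s_ge0 n : 0 <= s n.
Proof. by apply: sumr_ge0. Qed.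

Let s_le m n : (m <= n)%N -> s m <= s n.
Proof.
move=> /subnK <-; elim: (n - m)%N => // k IH.
by rewrite addSn sS (le_trans IH)// lerDl.
Qed.

Let sM : s M = 1.
Proof. by rewrite /s big_mkord. Qed.

Let block_measurable h k : measurable (block h k).
Proof.
rewrite (_ : block h k = [set t | V t < s h + W h * k] `\` [set t | V t < s h]).
  exact: measurableD.
apply/seteqP; split=> t /=; first by rewrite /block/= => /andP[hV ->]; split => //; rewrite ltNge hV.
by rewrite /block/= => -[-> /negP]; rewrite -leNgt andbT.
Qed.

Let block_prob (h : 'I_M) (k : R) : 0 <= k <= 1 -> P (block h k) = (W h * k)%:E.
Proof.
move=> /andP[k0 k1].
have sh1 : s h.+1 <= 1 by rewrite -sM s_le.
have Wk : W h * k <= W h by rewrite ler_piMr.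
have Wk0 : 0 <= W h * k by rewrite mulr_ge0.
have b1 : 0 <= s h + W h * k <= 1 by rewrite addr_ge0//=; rewrite sS in sh1; lra.
have a1 : 0 <= s h <= 1 by rewrite s_ge0/= -sM s_le// ltnW.
have E : [set t | V t < s h + W h * k] = block h k `|` [set t | V t < s h].
  apply/seteqP; rewrite /block; split=> t /=; last by move=> [/andP[]|]//; lra.
  by move=> tV; case: (leP (s h) (V t)) => ?; [left; rewrite tV andbT|right].
have : P [set t | V t < s h + W h * k] = (P (block h k) + P [set t | (V t < s h)%R])%E.
  rewrite E measureU//; apply/seteqP; split=> t //= -[/andP[hV _]].
  by rewrite /= ltNge hV.
rewrite !PV// -(@fineK _ (P (block h k))) ?fin_num_measure// -EFinD => -[E'].
by congr EFin; lra.
Qed.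

Let block_uniq (h h' : 'I_M) t :
  s h <= V t < s h + W h -> s h' <= V t < s h' + W h' -> h = h'.
Proof.
move=> /andP[a b] /andP[a' b']; apply: val_inj; rewrite -!sS in b b'.
apply/eqP; rewrite eqn_leq; apply/andP; split; rewrite leqNgt; apply/negP => /s_le lt.
  by have := lt_le_trans (le_lt_trans a b') lt; lra.
by have := lt_le_trans (le_lt_trans a' b) lt; lra.
Qed.

Let block1 (h : nat) t k : k <= 1 -> block h k t -> s h <= V t < s h + W h.
Proof.
move=> k1 /andP[-> /lt_le_trans]; apply; rewrite lerD2l ler_piMr//.
Qed.

Let UE (i : I) (h : 'I_M) t : s h <= V t < s h + W h ->
  U i t = ((cell i h)%:R + (V t - s h) / W h) / N%:R /\ 0 <= (V t - s h) / W h < 1.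
Proof.
move=> hV; rewrite /U; case: pickP => [h' h'V|/(_ h)]; last by rewrite hV.
have -> : h' = h by apply: block_uniq h'V hV.
move: hV => /andP[a b]; have Wh : 0 < W h by lra.
by rewrite divr_ge0 ?subr_ge0//= ltr_pdivrMr// mul1r; split=> //; lra.
Qed.

Let NR0 : 0 < N%:R :> R. Proof. by rewrite ltr0n. Qed.

Let U01 i t : 0 <= U i t <= 1.
Proof.
rewrite /U; case: pickP => [h hV|_]; last by rewrite ler01 lexx.
have [_ /andP[f0 f1]] := UE i hV; move: f0 f1; move: (_ / W h) => f f0 f1.
rewrite divr_ge0 ?addr_ge0//= ler_pdivrMr// mul1r.
have : (cell i h).+1%:R <= N%:R :> R by rewrite ler_nat.
by rewrite -natr1; lra.
Qed.

Let U_lt i (y : R) : y <= 1 ->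
  [set t | U i t < y] =
  \big[setU/set0]_(h < M) block h (clamp01 (N%:R * y - (cell i h)%:R)).
Proof.
move=> y1; apply/seteqP; split=> t /=; [move=> ty; apply/in_bigsetU; move: ty|].
  rewrite {1}/U; case: pickP => [h hV|_]; last by lra.
  have [_ /andP[f0 f1]] := UE i hV => lty; exists h => //; rewrite /block/=.
  move: (hV) => /andP[-> b]; have Wh : 0 < W h by lra.
  rewrite -ltrBlDl mulrC -ltr_pdivrMr// clamp01_gt//.
  by move: lty; rewrite ltr_pdivrMr// [y * _]mulrC; move: (_ / W h) => ?; lra.
move=> /in_bigsetU[h _ hb]; have /andP[k0 k1] := clamp01_bounds (N%:R * y - (cell i h)%:R).
have hV := block1 k1 hb; have [-> /andP[f0 f1]] := UE i hV.
move: hb => /andP[_]; move: (hV) => /andP[a b]; have Wh : 0 < W h by lra.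
rewrite -ltrBlDl mulrC -ltr_pdivrMr// clamp01_gt// => fy.
by rewrite ltr_pdivrMr// [y * _]mulrC; move: fy; move: (_ / W h) => ?; lra.
Qed.

Let U_measurable i : measurable_fun setT (U i).
Proof.
apply: measurable_fun_lt => y; have [y1|y1] := leP y 1.
  by rewrite U_lt//; apply: bigsetU_measurable => h _; exact: block_measurable.
rewrite (_ : [set t | _] = setT)//; apply/seteqP; split => // t _ /=.
by have /andP[_ ?] := U01 i t; lra.
Qed.

Let block_triv (k : 'I_M -> R) : (forall h, k h <= 1) ->
  trivIset setT (fun h : 'I_M => block h (k h)).
Proof.
move=> k1; apply/trivIsetP => h h' _ _ hh'; apply/seteqP; split=> t //= -[hb hb'].
by move/eqP: hh'; apply; apply: block_uniq (block1 (k1 h) hb) (block1 (k1 h') hb').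
Qed.

Let blocks_prob (A : pred 'I_M) (k : 'I_M -> R) : (forall h, 0 <= k h <= 1) ->
  P (\big[setU/set0]_(h < M | A h) block h (k h)) = (\sum_(h < M | A h) W h * k h)%:E.
Proof.
move=> k01; rewrite measure_bigsetU_ord//; last first.
  by apply: block_triv => h; have /andP[] := k01 h.
by rewrite -sumEFin; apply: eq_bigr => h _; exact: block_prob.
Qed.

Lemma weighted_coupling : exists U' : I -> {RV P >-> R},
  (forall i, uniform01 P (U' i)) /\
  forall A : pred 'I_M, exists E : set T, [/\ measurable E,
    P E = (\sum_(h < M | A h) W h)%:E &
    forall t, E t -> exists2 h, A h & forall i,
      0 <= U' i t <= (cell i h).+1%:R / N%:R].
Proof.
pose mU i : isMeasurableFun.axioms_ d _ T R (U i) := isMeasurableFun.Build _ _ _ _ (U i) (U_measurable i).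
pose U' i : {RV P >-> R} := HB.pack (U i) (mU i).
exists U'; split=> [i|A].
  apply: uniform01_cdf => [t|x /andP[x0 x1]]; first exact: U01.
  rewrite -[[set t | _]]/([set t | U i t < x]) U_lt//.
  rewrite blocks_prob => [|h]; last exact: clamp01_bounds.
  congr EFin.
  rewrite (partition_big (cell i) predT)//=.
  transitivity (\sum_(j < N) N%:R^-1 * clamp01 (N%:R * x - j%:R)).
    apply: eq_bigr => j _; rewrite -(Wcell i j) mulr_suml.
    by apply: eq_bigr => h /eqP ->.
  rewrite -mulr_sumr sum_clamp01; first by rewrite mulKf// gt_eqF.
  by rewrite mulr_ge0//= ler_piMr.
exists (\big[setU/set0]_(h < M | A h) block h 1); split.
- by apply: bigsetU_measurable => h _; exact: block_measurable.
- rewrite (blocks_prob _ (k := fun=> 1)) => [|h]; last by rewrite ler01 lexx.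
  by under eq_bigr do rewrite mulr1.
- move=> t /in_bigsetU[h Ah ht]; exists h => // i.
  have [UE1 /andP[f0 f1]] := UE i (block1 (lexx 1) ht).
  rewrite -[U' i t]/(U i t) UE1; move: f0 f1; move: (_ / W h) => f f0 f1.
  rewrite divr_ge0 ?addr_ge0//= ler_pM2r ?invr_gt0// -natr1 lerD2l ltW//.
Qed.
End weighted_coupling.

(** * Validity of the harmonic mean *)

Lemma cvg_pt_max (R : realType) (f g : R -> R) (x : R) :
  f @ x --> f x -> g @ x --> g x ->
  Num.max (f t) (g t) @[t --> x] --> Num.max (f x) (g x).
Proof. by move=> cf cg; exact: (@continuous_max R R f g x cf cg). Qed.

(** Since [0^-1 = 0], the inverse is the extension by 0 of a function continuous
    on the open set of nonzero reals. *)
Lemma measurable_invr (R : realType) : measurable_fun setT (fun x : R => x^-1).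
Proof.
rewrite (_ : (fun x : R => x^-1) = (fun x => if x == 0 then 0 else x^-1)); last first.
  by apply/funext => x; case: eqP => // ->; rewrite invr0.
apply: measurable_fun_if => //.
- by apply: measurable_fun_eqr; [exact: measurable_id|exact: measurable_cst].
- rewrite setTI (_ : _ @^-1` _ = [set x : R | x != 0]); last first.
    by apply/seteqP; split=> x /=; case: eqP.
  apply: open_continuous_measurable_fun; first exact: open_neq.
  by move=> x; rewrite inE/= => x0; apply: cvgV => //; exact: cvg_id.
Qed.

Section harmonic_mean.
Variables (R : realType) (m : nat).
Implicit Types p q : m.+1.-tuple R.

Lemma unit_cube_has0P p : unit_cube R m.+1 p ->
  [exists i, tnth p i == 0] = false -> forall i, 0 < tnth p i.
Proof.
move=> p01 /negbT /existsPn np0 i; have /andP[p0 _] := p01 i.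
by rewrite lt_neqAle p0 eq_sym np0.
Qed.

Lemma harmonic_mean_ge0 p : unit_cube R m.+1 p -> 0 <= tuple_harmonic_mean p.
Proof.
move=> p01; rewrite /tuple_harmonic_mean; case: ifP => // _.
rewrite invr_ge0 divr_ge0// sumr_ge0// => i _.
by rewrite invr_ge0; have /andP[] := p01 i.
Qed.

Lemma sum_inv_gt0 p : (forall i, 0 < tnth p i) -> 0 < \sum_(i < m.+1) (tnth p i)^-1.
Proof.
move=> p0; rewrite big_ord_recl ltr_wpDr ?invr_gt0//.
by apply: sumr_ge0 => i _; rewrite invr_ge0 ltW.
Qed.

Lemma harmonic_mean_mono (j : 'I_m.+1) p q :
  unit_cube R m.+1 p -> unit_cube R m.+1 q ->
  (forall i, i != j -> tnth p i = tnth q i) -> tnth p j <= tnth q j ->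
  tuple_harmonic_mean p <= tuple_harmonic_mean q.
Proof.
move=> p01 q01 pq pqj; rewrite {1}/tuple_harmonic_mean.
have pq_le i : tnth p i <= tnth q i.
  by have [->//|/pq ->] := eqVneq i j; rewrite lexx.
case: ifPn => [_|/negbTE np0]; first exact: harmonic_mean_ge0.
have p0 := unit_cube_has0P p01 np0.
have q0 i : 0 < tnth q i by apply: lt_le_trans (pq_le i).
rewrite /tuple_harmonic_mean ifF; last first.
  by apply/negbTE/existsPn => i; rewrite gt_eqF.
rewrite lef_pV2 ?posrE ?divr_gt0 ?sum_inv_gt0//.
rewrite ler_pM2r ?invr_gt0//; apply: ler_sum => i _.
by rewrite lef_pV2 ?posrE.
Qed.

Lemma harmonic_mean_le p (a eps : R) : 0 < a -> 0 < eps -> unit_cube R m.+1 p ->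
  (a * tuple_harmonic_mean p <= eps) =
  [exists i, tnth p i == 0] || (a * m.+1%:R / eps <= \sum_(i < m.+1) (tnth p i)^-1).
Proof.
move=> a0 eps0 p01; rewrite /tuple_harmonic_mean.
case: ifPn => [_|/negbTE np0]; first by rewrite mulr0 ltW.
have S0 := sum_inv_gt0 (unit_cube_has0P p01 np0).
rewrite invf_div mulrA ler_pdivrMr// ler_pdivrMr//.
by rewrite [eps * _]mulrC.
Qed.

Lemma measurable_harmonic_mean :
  measurable_fun setT (@tuple_harmonic_mean R m.+1).
Proof.
apply: measurable_fun_ifT => //.
- rewrite (_ : (fun p : m.+1.-tuple R => [exists i, tnth p i == 0]) =
    (fun p => \big[orb/false]_(i < m.+1) (tnth p i == 0))); last first.
    by apply/funext => p; rewrite big_orE.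
  elim: (index_enum _) => [|i s IH].
    rewrite (_ : (fun _ => _) = cst false); first exact: measurable_cst.
    by apply/funext => p; rewrite big_nil.
  rewrite (_ : (fun _ => _) = (fun p : m.+1.-tuple R => (tnth p i == 0) ||
     \big[orb/false]_(j <- s) (tnth p j == 0))); last first.
    by apply/funext => p; rewrite big_cons.
  apply: measurable_or => //.
  by apply: measurable_fun_eqr; [exact: measurable_tnth|exact: measurable_cst].
- apply: (measurableT_comp (@measurable_invr R)).
  apply: measurable_funM; last exact: measurable_cst.
  apply: measurable_sum => i; apply: (measurableT_comp (@measurable_invr R)).
  exact: measurable_tnth.
Qed.
End harmonic_mean.

(** With [r = (k + y) / ((1 + y) * eps)], the affine function
    [(1 / u - r) / (r * y)] of [1 / u] is 1 at [eps / (k + y)] and 0 at [1 / r].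
    Truncating [u] from below keeps the function at most 1 and continuous. *)
Definition dual_fun (R : realType) (k y eps u : R) : R :=
  let r := (k + y) / ((1 + y) * eps) in
  Num.max 0 (((Num.max u (eps / (k + y)))^-1 - r) / (r * y)).

Section dual_fun.
Variables (R : realType) (k y eps : R).
Implicit Types u : R.

Lemma dual_fun_ge0 u : 0 <= dual_fun k y eps u.
Proof. by rewrite le_max lexx. Qed.

Lemma dual_fun_continuous : 0 < k -> 0 < y -> 0 < eps -> continuous (dual_fun k y eps).
Proof.
move=> k0 y0 e0 u; rewrite /dual_fun; apply: cvg_pt_max; first exact: cvg_cst.
apply: cvgM; last exact: cvg_cst.
apply: cvgB; last exact: cvg_cst.
apply: cvgV; last by apply: cvg_pt_max; [exact: cvg_id|exact: cvg_cst].
by apply: lt0r_neq0; rewrite lt_max divr_gt0 ?orbT//; lra.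
Qed.

Lemma dual_fun_small u : 0 < k -> 0 < y -> 0 < eps -> u <= eps / (k + y) ->
  dual_fun k y eps u = 1.
Proof.
move=> k0 y0 e0 uu; rewrite /dual_fun (max_idPr uu).
have -> : ((eps / (k + y))^-1 - (k + y) / ((1 + y) * eps)) /
    ((k + y) / ((1 + y) * eps) * y) = 1.
  by field; repeat (apply/andP; split); rewrite gt_eqF//; lra.
by rewrite max_r.
Qed.

Lemma dual_fun_ge u : 0 < k -> 0 < y -> 0 < eps -> eps / (k + y) < u ->
  (u^-1 - (k + y) / ((1 + y) * eps)) / ((k + y) / ((1 + y) * eps) * y) <=
  dual_fun k y eps u.
Proof. by move=> k0 y0 e0 uu; rewrite /dual_fun (max_idPl (ltW uu)) le_max lexx orbT. Qed.

Lemma dual_fun_le1 u : 0 < k -> 0 < y -> 0 < eps -> dual_fun k y eps u <= 1.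
Proof.
move=> k0 y0 e0; rewrite ge_max ler01/=.
set r := (k + y) / _; have r0 : 0 < r by rewrite divr_gt0 ?mulr_gt0//; lra.
have ry0 : 0 < r * y by rewrite mulr_gt0.
rewrite (ler_pdivrMr _ _ ry0) mul1r.
suff : (Num.max u (eps / (k + y)))^-1 <= r * (1 + y) by lra.
have -> : r * (1 + y) = (eps / (k + y))^-1.
  by rewrite /r; field; repeat (apply/andP; split); rewrite gt_eqF//; lra.
have u10 : 0 < eps / (k + y) by rewrite divr_gt0//; lra.
by rewrite lef_pV2 ?posrE ?lt_max ?u10 ?orbT// le_max lexx orbT.
Qed.

(** Bound the increments over three intervals: by the length of the first, where
    the function is 1; by those of an explicit primitive [G] up to [1 / r]; by 0
    beyond. The sum is [eps / k] once [excess k y = 0] eliminates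
    [ln (1 + y)]. *)
Lemma dual_fun_primitive (H : R -> R) : 2 < k -> 0 < y -> 0 < eps < 1 -> excess k y = 0 ->
  (forall x : R, -1 < x -> is_derive x 1 H (dual_fun k y eps x)) ->
  H 1 - H 0 <= eps / k.
Proof.
move=> k2 y0 /andP[e0 e1] Ey dH; have k0 : 0 < k by lra.
pose r := (k + y) / ((1 + y) * eps).
have r0 : 0 < r by rewrite divr_gt0 ?mulr_gt0//; lra.
pose u1 := eps / (k + y); pose u2 := u1 * (1 + y).
have u10 : 0 < u1 by rewrite divr_gt0//; lra.
have ru2 : r * u2 = 1.
  by rewrite /r /u2 /u1; field; repeat (apply/andP; split); rewrite gt_eqF//; lra.
have u12 : u1 <= u2 by rewrite ler_peMr; lra.
have u21 : u2 <= 1 by rewrite /u2 /u1 mulrAC ler_pdivrMr; nra.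
have part1 : H u1 - H 0 <= 1 * (u1 - 0).
  apply: (derive_le_incr (ltW u10)) => [x /andP[x0 _]|x _]; first by apply: dH; lra.
  exact: dual_fun_le1.
have part3 : H 1 - H u2 <= 0 * (1 - u2).
  apply: (derive_le_incr u21) => [x /andP[x0 _]|x /andP[x2 _]]; first by apply: dH; lra.
  rewrite /dual_fun -/r -/u1 ge_max lexx/= (max_idPl _); last by lra.
  apply: mulr_le0_ge0; last by rewrite invr_ge0 mulr_ge0// ltW.
  rewrite subr_le0.
  have u20 : 0 < u2 by lra.
  have -> : r = u2^-1 by rewrite -[LHS]mulr1 -(mulfV (lt0r_neq0 u20)) mulrA ru2 mul1r.
  by rewrite lef_pV2 ?posrE//; lra.
pose G x := (ln x - r * x) / (r * y).
have part2 : (H u2 - G u2) - (H u1 - G u1) <= 0 * (u2 - u1).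
  apply: (@derive_le_incr R (fun x => H x - G x)
     (fun x => dual_fun k y eps x - (x^-1 - r) / (r * y)) _ _ _ u12)
    => [x /andP[x1 _]|x /andP[x1 x2]].
    have ? : is_derive x 1 H (dual_fun k y eps x) by apply: dH; lra.
    by rewrite /G; derive_tac; [lra|ring].
  rewrite subr_le0 /dual_fun -/r -/u1 ge_max (max_idPl (ltW x1)) lexx andbT.
  apply: divr_ge0; last by rewrite mulr_ge0// ltW.
  rewrite subr_ge0.
  have u20 : 0 < u2 by lra.
  have -> : r = u2^-1 by rewrite -[LHS]mulr1 -(mulfV (lt0r_neq0 u20)) mulrA ru2 mul1r.
  by rewrite lef_pV2 ?posrE//; lra.
have GE : G u2 - G u1 = eps / k - u1.
  have lnE : ln (1 + y) = y * (y + k) / (k * (y + 1)).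
    by apply/eqP; rewrite -subr_eq0; apply/eqP.
  have y1 : 0 < 1 + y by lra.
  rewrite /G /u2 lnM ?posrE// lnE /r /u1.
  by field; repeat (apply/andP; split); rewrite gt_eqF//; lra.
lra.
Qed.

End dual_fun.

(** If some [p i] is small, its term alone is 1. Otherwise each term is at least
    the affine function of [1 / p i], and the threshold [r * (k + y)] is where
    these affine functions sum to 1. *)
Lemma dual_fun_sum_ge1 (R : realType) (m : nat) (y eps : R) (p : 'I_m.+1 -> R) :
  0 < y -> 0 < eps -> (forall i, 0 <= p i) ->
  (exists i, p i = 0) \/
    (m.+1%:R + y) ^+ 2 / ((1 + y) * eps) <= \sum_(i < m.+1) (p i)^-1 ->
  1 <= \sum_(i < m.+1) dual_fun m.+1%:R y eps (p i).
Proof.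
move=> y0 e0 p0 H; set k : R := m.+1%:R; have k0 : 0 < k by rewrite ltr0n.
have u10 : 0 < eps / (k + y) by rewrite divr_gt0//; lra.
have [[i pi]|/forallNP big_p] := pselect (exists i, p i <= eps / (k + y)).
  by rewrite (bigD1 i)//= dual_fun_small// lerDl sumr_ge0// => j _; exact: dual_fun_ge0.
have {}big_p i : eps / (k + y) < p i by rewrite ltNge; apply/negP; exact: big_p.
have {}H : (k + y) ^+ 2 / ((1 + y) * eps) <= \sum_(i < m.+1) (p i)^-1.
  by case: H => // -[i pi0]; have := big_p i; rewrite pi0; lra.
set r := (k + y) / ((1 + y) * eps).
have r0 : 0 < r by rewrite divr_gt0 ?mulr_gt0//; lra.
apply: (@le_trans _ _ (\sum_(i < m.+1) ((p i)^-1 - r) / (r * y))); last first.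
  by apply: ler_sum => i _; exact: dual_fun_ge.
rewrite -mulr_suml sumrB sumr_const card_ord -[r *+ _]mulr_natl -/k.
have ry0 : 0 < r * y by rewrite mulr_gt0.
rewrite (ler_pdivlMr _ _ ry0) mul1r.
have : (k + y) ^+ 2 / ((1 + y) * eps) = r * (k + y) by rewrite /r expr2; ring.
lra.
Qed.

Lemma uniform01_integral (d : measure_display) (T : measurableType d) (R : realType)
    (P : probability T R) (U : {RV P >-> R}) (f F : R -> R) :
  uniform01 P U -> continuous f -> (forall x : R, 0 <= f x) ->
  (forall x : R, -1 < x -> is_derive x 1 F (f x)) ->
  (\int[P]_t (f (U t))%:E = (F 1 - F 0)%:E)%E.
Proof.
move=> [_ UA] cf f0 dF.
have mf : measurable_fun (setT : set R) (EFin \o f).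
  by apply/measurable_EFinP; exact: continuous_measurable_fun.
transitivity (\int[distribution P U]_x (EFin \o f) x)%E.
  by rewrite ge0_integral_distribution// => x; rewrite lee_fin.
rewrite (eq_measure_integral (distribution (uniform_prob (@ltr01 R)) (@borel_id R)));
  last by move=> A mA _; exact: UA.
rewrite ge0_integral_distribution//.
rewrite integral_uniform//.
rewrite subr0 invr1 mul1e (@continuous_FTC2 R f F 0 1)//.
- exact: continuous_subspaceT.
- split.
  + move=> x; rewrite in_itv/= => /andP[x0 _].
    have ? : is_derive x 1 F (f x) by apply: dF; lra.
    exact: ex_derive.
  + apply: cvg_at_right_filter; apply: differentiable_continuous.
    have ? : is_derive (0 : R) 1 F (f 0) by apply: dF; lra.
    by apply/derivable1_diffP; exact: ex_derive.
  + apply: cvg_at_left_filter; apply: differentiable_continuous.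
    have ? : is_derive (1 : R) 1 F (f 1) by apply: dF; lra.
    by apply/derivable1_diffP; exact: ex_derive.
- move=> x; rewrite in_itv/= => /andP[x0 _].
  have ? : is_derive x 1 F (f x) by apply: dF; lra.
  by rewrite derive1E derive_val.
Qed.

Section harmonic_event.
Variables (d : measure_display) (T : measurableType d) (R : realType)
  (P : probability T R) (m : nat).
Implicit Types (U : 'I_m.+1 -> {RV P >-> R}) (a eps : R).

Lemma uniform01_unit_cube U t : (forall i, uniform01 P (U i)) ->
  unit_cube R m.+1 [tuple U i t | i < m.+1].
Proof. by move=> hU i; rewrite tnth_mktuple; have [U01 _] := hU i. Qed.

Lemma harmonic_event_measurable U a eps :
  measurable [set t | a * tuple_harmonic_mean [tuple U i t | i < m.+1] <= eps].
Proof.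
have mF : measurable_fun setT
    (fun t => a * tuple_harmonic_mean [tuple U i t | i < m.+1]).
  apply: measurable_funM; first exact: measurable_cst.
  apply: (measurableT_comp (@measurable_harmonic_mean R m)).
  apply/measurable_fun_tnthP => i.
  rewrite (_ : _ \o _ = U i)//.
  by apply/funext => t /=; rewrite tnth_mktuple.
rewrite (_ : mkset _ = [set: T] `&` (fun t => a * tuple_harmonic_mean [tuple U i t | i < m.+1])
   @^-1` `]-oo, eps]%classic); first exact: mF.
by apply/seteqP; split=> t /=; rewrite in_itv//= => -[].
Qed.

(** The indicator of the event is at most the sum of the dual functions of the
    [U i], and each of these has the same integral, at most [eps / k], whatever
    the dependence. *)
Lemma merging_sup_le (y eps : R) : let k : R := m.+1%:R in
  2 < k -> 0 < y -> 0 < eps < 1 -> excess k y = 0 ->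
  (merging_sup P (fun p : m.+1.-tuple R =>
     ((y + k) ^+ 2 / ((y + 1) * k) * tuple_harmonic_mean p)%R) eps <= eps%:E)%E.
Proof.
move=> k k2 y0 eps01 Ey; have /andP[e0 e1] := eps01; have k0 : 0 < k by lra.
set a := (y + k) ^+ 2 / ((y + 1) * k).
have a0 : 0 < a by rewrite divr_gt0 ?exprn_gt0 ?mulr_gt0//; lra.
have h0 := @dual_fun_ge0 R k y eps.
have ch := dual_fun_continuous k0 y0 e0.
apply: ge_ereal_sup => _ [U hU <-].
have [H dH] := antiderivative (-1) ch.
set E := [set t | _]; have mE : measurable E by exact: harmonic_event_measurable.
have mh i : measurable_fun setT (fun t => (dual_fun k y eps (U i t))%:E).
  apply/measurable_EFinP; apply: (measurableT_comp (f := dual_fun k y eps)) => //.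
  exact: continuous_measurable_fun.
have -> : P E = (\int[P]_t (\1_E t)%:E)%E by rewrite integral_indic// setIT.
apply: (@le_trans _ _ (\int[P]_t (\sum_(i < m.+1) (dual_fun k y eps (U i t))%:E))%E).
  apply: ge0_le_integral => //.
  - by apply/measurable_EFinP; exact: measurable_indic.
  - exact: emeasurable_sum.
  move=> t _; rewrite sumEFin lee_fin indicE; case: (boolP (t \in E)) => [|_]; last first.
    by apply: sumr_ge0.
  rewrite inE /E/= (harmonic_mean_le a0 e0 (uniform01_unit_cube t hU)) => Et.
  apply: dual_fun_sum_ge1 => //.
    by move=> i; have [/(_ t)/andP[]] := hU i.
  move: Et => /orP[/existsP[i]|Et].
    by rewrite tnth_mktuple => /eqP ?; left; exists i.
  right; have -> : (m.+1%:R + y) ^+ 2 / ((1 + y) * eps) = a * m.+1%:R / eps.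
    rewrite -/k /a; field; repeat (apply/andP; split); rewrite gt_eqF//; lra.
  by under eq_bigr do rewrite -(tnth_mktuple (fun i => U i t)).
rewrite ge0_integral_sum//; last by move=> i t _; rewrite lee_fin.
rewrite (eq_bigr (fun=> (H 1 - H 0)%:E)); last first.
  by move=> i _; apply: uniform01_integral.
rewrite sumEFin lee_fin sumr_const card_ord -[_ *+ m.+1]mulr_natl -/k.
have := dual_fun_primitive k2 y0 eps01 Ey dH.
by rewrite ler_pdivlMr// mulrC.
Qed.
End harmonic_event.

(** * Precision of the harmonic mean *)

(** Dual functions on cells, made continuous: at most 1, at most [psi j] beyond
    the right end of cell [j], and, where it is below 1, at least [psi j] for a
    cell [j] that starts before [u]. The last property loses at most one cell in
    the position of [u]. *)
Definition monotone_regularization (R : realType) (N : nat) (psi : 'I_N -> R) (u : R) : R :=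
  \big[Num.min/1]_(j < N) (psi j + Num.max 0 (j.+1%:R - N%:R * u)).

Section monotone_regularization.
Variables (R : realType) (N : nat) (psi : 'I_N -> R).
Hypothesis psi0 : forall j, 0 <= psi j.
Local Notation reg := (monotone_regularization psi).

Lemma regularization_ge0 u : 0 <= reg u.
Proof.
apply: (big_ind (fun v => 0 <= v)) => //= [v w v0 w0|j _].
  by rewrite le_min v0.
by rewrite addr_ge0// le_max lexx.
Qed.

Lemma regularization_le1 u : reg u <= 1.
Proof. exact: bigmin_le_id. Qed.

Lemma regularization_le (j : 'I_N) (u : R) : j.+1%:R <= N%:R * u -> reg u <= psi j.
Proof.
move=> ju; apply: (@bigmin_inf _ _ _ _ j) => //.
by rewrite (max_idPl _) ?addr0 ?subr_le0.
Qed.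

Lemma regularization_attained u : reg u = 1 \/
  exists2 j, psi j <= reg u & reg u < 1 -> j%:R < N%:R * u.
Proof.
apply: (big_ind (fun v => v = 1 \/ exists2 j, psi j <= v & v < 1 -> j%:R < N%:R * u)).
- by left.
- by move=> v w Hv Hw; case: (leP v w).
- move=> j _; right; exists j; first by rewrite lerDl le_max lexx.
  have := psi0 j; have : j.+1%:R - N%:R * u <= Num.max 0 (j.+1%:R - N%:R * u).
    by rewrite le_max lexx orbT.
  by rewrite -natr1; move: (Num.max _ _) => v; lra.
Qed.

Lemma regularization_continuous : continuous reg.
Proof.
rewrite /monotone_regularization => u.
elim: (index_enum _) => [|j s IH].
  rewrite (_ : (fun u : R => _) = cst 1); first exact: cvg_cst.
  by apply/funext => v; rewrite big_nil.
rewrite (_ : (fun u : R => _) = (fun u : R =>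
    Num.min (psi j + Num.max 0 (j.+1%:R - N%:R * u))
    (\big[Num.min/1]_(j <- s) (psi j + Num.max 0 (j.+1%:R - N%:R * u))))); last first.
  by apply/funext => v; rewrite big_cons.
apply: (@continuous_min R R _ _ u) => //.
apply: cvgD; first exact: cvg_cst.
apply: (@cvg_pt_max R (cst 0) (fun v => j.+1%:R - N%:R * v)); first exact: cvg_cst.
apply: cvgB; first exact: cvg_cst.
by apply: cvgM; [exact: cvg_cst|exact: cvg_id].
Qed.
End monotone_regularization.

(** On the cell after cell [j] the regularization is at most [psi j], on the first
    one at most 1. *)
Lemma regularization_primitive (R : realType) (N : nat) (psi : 'I_N.+1 -> R) (F : R -> R) :
  (forall j, 0 <= psi j) ->
  (forall x : R, -1 < x -> is_derive x 1 F (monotone_regularization psi x)) ->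
  F 1 - F 0 <= (1 + \sum_j psi j) / N.+1%:R.
Proof.
move=> psi0 dF; have N0 : (0 : R) < N.+1%:R by rewrite ltr0n.
have dF' (x y z : R) : 0 <= x -> x <= z <= y -> is_derive z 1 F (monotone_regularization psi z).
  by move=> x0 /andP[xz _]; apply: dF; lra.
have step (n : nat) (c : R) : (forall x : R, n%:R / N.+1%:R < x < n.+1%:R / N.+1%:R ->
    monotone_regularization psi x <= c) ->
    F (n.+1%:R / N.+1%:R) - F (n%:R / N.+1%:R) <= c / N.+1%:R.
  move=> Hc; have -> : c / N.+1%:R = c * (n.+1%:R / N.+1%:R - n%:R / N.+1%:R).
    by rewrite -mulrBl -[n.+1%:R]natr1 addrAC subrr add0r mul1r.
  apply: derive_le_incr Hc; first by rewrite ler_pM2r ?invr_gt0// ler_nat.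
  by move=> x; apply: dF'; rewrite divr_ge0.
have rec n : (n <= N)%N ->
    F (n.+1%:R / N.+1%:R) - F 0 <= (1 + \sum_(j < n) psi (inord j)) / N.+1%:R.
  elim: n => [_|n IH nN].
    rewrite big_ord0 addr0; have := step 0%N 1; rewrite mul0r; apply => x _.
    exact: regularization_le1.
  rewrite big_ord_recr/= addrA [leRHS]mulrDl [leRHS]addrC.
  rewrite -[leLHS](subrKA (F (n.+1%:R / N.+1%:R))) lerD ?IH ?(ltnW nN)//.
  apply: step => x /andP[nx _]; apply: regularization_le => //.
  rewrite inordK ?ltnS 1?ltnW//; move: nx; rewrite ltr_pdivrMr// => /ltW.
  by rewrite mulrC.
have := rec N (leqnn N); rewrite divff ?gt_eqF// => /le_trans; apply.
rewrite ler_pM2r ?invr_gt0// lerD2l [leRHS]big_ord_recr/=.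
rewrite (eq_bigr (fun i : 'I_N => psi (widen_ord (leqnSn N) i))) ?lerDl//.
move=> i _; congr psi; apply: val_inj; rewrite /= inordK//.
by rewrite ltnS ltnW.
Qed.

(** A coordinate below about [1 / s] has an inverse that suffices alone.
    Otherwise all coordinates are at least [1 / (2 * s)], and adding [del] changes
    their inverses by a factor at least [s / s']. *)
Lemma shrink_inverse_sum (R : realType) (K : nat) (u : 'I_K -> R) (s s' del : R) :
  0 < s -> s < s' -> (forall i, 0 < u i) ->
  0 < del -> del <= (2 * s)^-1 -> del <= (2 * s)^-1 * (s' / s - 1) ->
  s' <= \sum_i (u i)^-1 -> s <= \sum_i (u i + del)^-1.
Proof.
move=> s0 ss' u0 d0 d1 d2 Hs.
have ud i : 0 < u i + del by rewrite addr_gt0.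
have [[i ui]|/forallNP big_u] := pselect (exists i, u i + del <= s^-1).
  rewrite (bigD1 i)//= -[leLHS]addr0 lerD//.
    by rewrite -[leLHS]invrK lef_pV2 ?posrE ?invr_gt0.
  by apply: sumr_ge0 => j _; rewrite invr_ge0 ltW.
have Es : s^-1 = 2 * (2 * s)^-1 by field; rewrite gt_eqF.
have {}big_u i : (2 * s)^-1 <= u i.
  have := big_u i => /negP; rewrite -ltNge Es; move: ((2 * s)^-1) d1 => h d1; lra.
have ratio i : s / s' * (u i)^-1 <= (u i + del)^-1.
  have s'0 : 0 < s' by lra.
  rewrite -[leLHS]invrK lef_pV2 ?posrE ?invr_gt0 ?mulr_gt0 ?invr_gt0//.
  rewrite invfM invrK invf_div.
  have : (2 * s)^-1 * (s' / s - 1) <= u i * (s' / s - 1).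
    by rewrite ler_pM2r// subr_gt0 ltr_pdivlMr// mul1r.
  move: (s' / s) d2 => r; move: ((2 * s)^-1 * _) => q d2; lra.
have -> : s = s / s' * s' by rewrite mulfVK// gt_eqF//; lra.
apply: (@le_trans _ _ (s / s' * \sum_i (u i)^-1)).
  by rewrite ler_pM2l// divr_gt0//; lra.
by rewrite mulr_sumr; apply: ler_sum => i _.
Qed.

(** Apply [continuous_dual_bound] to the regularization, at a level [e] strictly
    between [tau] and [eps]. On a fine subdivision, the room between [e] and [eps]
    absorbs the shift of the points by one cell, and the room between [tau] and
    [e] the contribution of the first cell to the integral. *)
Lemma discrete_dual_bound (R : realType) (m : nat) (y eps tau : R) :
  let k : R := m.+1%:R in
  (1 < m)%N -> k - 2 < y -> excess k y = 0 -> 0 < eps < 1 -> 0 <= tau < eps ->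
  exists N : nat, forall psi : 'I_N.+1 -> R, (forall j, 0 <= psi j) ->
    (forall t : {ffun 'I_m.+1 -> 'I_N.+1},
       (k + y) ^+ 2 / ((1 + y) * eps) <= \sum_i ((t i).+1%:R / N.+1%:R)^-1 ->
       1 <= \sum_i psi (t i)) ->
    tau <= k / N.+1%:R * \sum_j psi j.
Proof.
move=> k m1 ky Ey /andP[e0 e1] /andP[tau0 taue].
have k3 : 3 <= k by rewrite ler_nat.
pose e := (tau + eps) / 2; have ee : tau < e < eps by rewrite /e; lra.
pose s := (k + y) ^+ 2 / ((1 + y) * eps).
pose s' := (k + y) ^+ 2 / ((1 + y) * e).
have s0 : 0 < s by rewrite divr_gt0 ?exprn_gt0 ?mulr_gt0//; lra.
have ss' : s < s'.
  rewrite ltr_pM2l ?exprn_gt0//; last by lra.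
  rewrite ltf_pV2 ?posrE ?mulr_gt0//; try lra.
  by rewrite ltr_pM2l; lra.
pose d := Num.min ((e - tau) / k) (Num.min (2 * s)^-1 ((2 * s)^-1 * (s' / s - 1))).
have d0 : 0 < d.
  have hs : 0 < (2 * s)^-1 by rewrite invr_gt0 mulr_gt0.
  rewrite !lt_min hs (pmulr_rgt0 _ hs) subr_gt0 (ltr_pdivlMr _ _ s0) mul1r ss' !andbT.
  by apply: divr_gt0; lra.
have [N _ /(_ N (leqnn N)) /= HN] := near_infty_natSinv_lt (PosNum d0).
exists N => psi psi0 Hpsi.
have N0 : (0 : R) < N.+1%:R by rewrite ltr0n.
have := ltW HN; rewrite !le_min => /and3P[N1 N2 N3].
have creg := @regularization_continuous R N.+1 psi.
have [F dF] := antiderivative (-1) creg.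
have := @continuous_dual_bound R _ F m y e m1 ky Ey _ creg dF (regularization_ge0 psi0).
rewrite -/k => H.
have {}H : e <= k * (F 1 - F 0).
  apply: H => [|u0 u u01 u1 Hu]; first by lra.
  pose v (i : 'I_m.+1) := oapp (fun j : 'I_m => u j) u0 (unlift ord0 i).
  have vE (f : R -> R) : f u0 + \sum_(i < m) f (u i) = \sum_i f (v i).
    rewrite big_ord_recl /v unlift_none/=; congr (_ + _).
    by apply: eq_bigr => i _; rewrite liftK.
  have v0 i : 0 < v i.
    by rewrite /v; case: unliftP => /= [j _|_]; [have /andP[] := u1 j|have /andP[] := u01].
  rewrite (vE (monotone_regularization psi)).
  rewrite (vE (fun x => x^-1)) in Hu.
  have [[i vi]|/forallNP v_lt] := pselect (exists i, monotone_regularization psi (v i) = 1).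
    rewrite (bigD1 i)//= vi lerDl; apply: sumr_ge0 => j _; exact: regularization_ge0.
  have /choice[t tP] (i : 'I_m.+1) : exists j : 'I_N.+1,
      psi j <= monotone_regularization psi (v i) /\ (j%:R : R) < N.+1%:R * v i.
    have [/v_lt//|[j pj jN]] := regularization_attained psi0 (v i).
    exists j; split => //; apply: jN; rewrite lt_neqAle regularization_le1 andbT.
    by apply/eqP; exact: v_lt.
  apply: (@le_trans _ _ (\sum_i psi (t i))); last first.
    by apply: ler_sum => i _; have [] := tP i.
  have := Hpsi [ffun i => t i]; under [X in _ <= X]eq_bigr do rewrite ffunE.
  move=> H'; apply: le_trans (H' _) _; last first.
    by rewrite le_eqVlt; apply/orP; left; apply/eqP; apply: eq_bigr => i _; rewrite ffunE.
  apply: le_trans (shrink_inverse_sum s0 ss' v0 _ N2 N3 Hu) _; first by rewrite invr_gt0.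
  apply: ler_sum => i _; rewrite lef_pV2 ?posrE ?divr_gt0 ?ltr0Sn ?addr_gt0 ?invr_gt0//.
  rewrite -natr1 mulrDl mul1r lerD2r ler_pdivrMr// mulrC.
  by have [_ /ltW] := tP i.
have HF := regularization_primitive psi0 dF.
have : k * (F 1 - F 0) <= k * ((1 + \sum_j psi j) / N.+1%:R) by rewrite ler_pM2l//; lra.
have : k * N.+1%:R^-1 <= e - tau by rewrite mulrC -ler_pdivlMr//; lra.
rewrite mulrDl mul1r mulrDr mulrA [k * _ / _]mulrAC.
by move: (k * _^-1) (_ / _ * \sum_j _) => p q; lra.
Qed.

Section sharpness.
Variables (d : measure_display) (T : measurableType d) (R : realType)
  (P : probability T R) (m : nat).

(** A tuple of cells is good if the sum of inverses reaches the threshold at the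
    right end points of the cells; then it reaches it at all points of the
    product of these cells with nonzero coordinates. *)
Lemma merging_sup_ge (y eps tau : R) : let k : R := m.+1%:R in
  atomless P -> (1 < m)%N -> k - 2 < y -> excess k y = 0 -> 0 < eps < 1 ->
  0 <= tau < eps ->
  (tau%:E <= merging_sup P (fun p : m.+1.-tuple R =>
     ((y + k) ^+ 2 / ((y + 1) * k) * tuple_harmonic_mean p)%R) eps)%E.
Proof.
move=> k hP m1 ky Ey eps01 tau01; have /andP[e0 e1] := eps01.
have /andP[tau0 _] := tau01.
have k3 : 3 <= k by rewrite ler_nat.
have [N HN] := discrete_dual_bound m1 ky Ey eps01 tau01.
pose s := (k + y) ^+ 2 / ((1 + y) * eps).
pose good (t : {ffun 'I_m.+1 -> 'I_N.+1}) := s <= \sum_i ((t i).+1%:R / N.+1%:R)^-1.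
have good_shift (t : {ffun 'I_m.+1 -> 'I_N.+1}) (c : 'I_m.+1) :
    good t -> good [ffun i => t (i + c)].
  rewrite /good (reindex_inj (addIr c))/= => /le_trans; apply.
  by rewrite le_eqVlt; apply/orP; left; apply/eqP; apply: eq_bigr => i _; rewrite ffunE.
have [W [W0 W1 Wm Wg]] := discrete_coupling (isT : (0 < N.+1)%N) tau0 good_shift HN.
pose M := #|{ffun 'I_m.+1 -> 'I_N.+1}|.
pose tup (h : 'I_M) : {ffun 'I_m.+1 -> 'I_N.+1} := enum_val h.
pose w n := oapp (fun h : 'I_M => W (tup h)) 0 (insub n).
have wE (A : pred {ffun 'I_m.+1 -> 'I_N.+1}) :
    \sum_(h < M | A (tup h)) w h = \sum_(t | A t) W t.
  rewrite [RHS](reindex tup); last exact/onW_bij/enum_val_bij.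
  by apply: eq_bigr => h _; rewrite /w valK.
have [V [V01 mV PV]] := exists_uniform hP.
have [||i j|U [hU UE]] := @weighted_coupling d T R P V M N.+1 'I_m.+1 w
  (fun i h => tup h i) isT mV PV.
- by move=> n; rewrite /w; case: insub => //= h; exact: W0.
- by rewrite (wE xpredT).
- by rewrite (wE (fun t => t i == j)) Wm.
have [E [mE PE EP]] := UE (fun h => good (tup h)).
apply: (@le_trans _ _ (P E)); first by rewrite PE wE lee_fin.
apply: ereal_sup_ge; exists (P [set t | (y + k) ^+ 2 / ((y + 1) * k) *
  tuple_harmonic_mean [tuple U i t | i < m.+1] <= eps]); first by exists U.
apply: le_measure; rewrite ?inE//; first exact: harmonic_event_measurable.
move=> t /EP[h gh Uh]; have k0 : 0 < k by lra.
have a0 : 0 < (y + k) ^+ 2 / ((y + 1) * k) by rewrite divr_gt0 ?exprn_gt0 ?mulr_gt0//; lra.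
rewrite /= (harmonic_mean_le a0 e0 (uniform01_unit_cube t hU)).
case: (boolP [exists i, _]) => //= /existsPn U0.
apply: (@le_trans _ _ s).
  rewrite le_eqVlt; apply/orP; left; apply/eqP; rewrite -/k /s.
  by field; repeat (apply/andP; split); rewrite gt_eqF//; lra.
apply: le_trans gh _; apply: ler_sum => i _.
have /andP[Ui0 UiN] := Uh i; rewrite tnth_mktuple.
rewrite lef_pV2 ?posrE ?divr_gt0//.
by rewrite lt_neqAle Ui0 andbT eq_sym; have := U0 i; rewrite tnth_mktuple.
Qed.
End sharpness.

Theorem proposition9 (R : realType) (d : measure_display)
    (T : measurableType d) (P : probability T R) (hP : atomless P) :
  [/\ forall K : nat, (2 < K)%N -> exists! y : R, y_spec R K y,
      forall K : nat, (2 < K)%N ->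
        precise_merging_function P
          (fun p : K.-tuple R => aH R K * tuple_harmonic_mean p),
      forall K : nat, (2 < K)%N -> aH R K <= expR 1 * ln (K%:R : R) &
      aH R K / ln (K%:R : R) @[K --> \oo] --> (1 : R)].
Proof.
split; [|move=> K K2|exact: aH_le_elnK|exact: aH_ratio_cvg].
  move=> K K2; have [y yK _] := y_spec_exists R K2.
  by exists y; split=> // z; exact: y_spec_unique K2 yK.
have ky := yH_gt R K2; have [y0 Ey] := (y_spec_excess _ K2).1 (yHP R K2).
case: K K2 ky y0 Ey => // m K2 ky y0 Ey.
have k2 : (2 : R) < m.+1%:R by rewrite ltr_nat.
have sup_le (eps : R) : 0 < eps < 1 -> (merging_sup P
    (fun p : m.+1.-tuple R => aH R m.+1 * tuple_harmonic_mean p)%R eps <= eps%:E)%E.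
  by move=> e01; exact: merging_sup_le.
have a0 : 0 <= aH R m.+1.
  by rewrite /aH divr_ge0 ?exprn_ge0 ?mulr_ge0//; lra.
split; first split => //.
- apply: measurable_funM; first exact: measurable_cst.
  apply: measurable_funTS; exact: measurable_harmonic_mean.
- by move=> p p01; rewrite mulr_ge0// harmonic_mean_ge0.
- by move=> j p q p01 q01 pq pqj; rewrite ler_wpM2l//; exact: harmonic_mean_mono pq pqj.
move=> eps e01; apply/eqP; rewrite eq_le sup_le//=.
have /andP[e0 e1] := e01.
apply/lee_subgt0Pr => del del0; rewrite -EFinD.
have [de|ed] := leP del eps.
  by apply: merging_sup_ge => //; apply/andP; split; lra.
apply: (@le_trans _ _ 0%:E); first by rewrite lee_fin; lra.
by apply: merging_sup_ge => //; rewrite lexx.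
Qed.
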